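(* The set of functionals $(S,Q)\mapsto\log f_\alpha(S,Q)$, where $f_\alpha$ ranges over $\Delta(\mathcal{A},\le)$ (with $f\in\Delta(\mathcal{G},\le)$, $\alpha\ge1$), is convex under pointwise convex combinations. Explicitly: if $f_\alpha,g_\beta\in\Delta(\mathcal{A},\le)$, $\lambda\in[0,1]$, $h\in\Delta(\mathcal{G},\le)$ satisfies $\log h(G,P)=\lambda\log f(G,P)+(1-\lambda)\log g(G,P)$ for all nonempty graphs $G$ and $P\in\mathcal{P}(V(G))$, and $\gamma=\lambda\alpha+(1-\lambda)\beta$, then $h_\gamma\in\Delta(\mathcal{A},\le)$.
   Context: Graphs are finite simple undirected; $x\simeq x'$ means equal or adjacent. Strong product $G\boxtimes H$: $(g,h)\simeq(g',h')$ iff $g\simeq g'$ and $h\simeq h'$. $H\le G$ for graphs means a homomorphism $\overline{H}\to\overline{G}$ exists. $\Delta(\mathcal{G},\le)$: maps from graphs to $\mathbb{R}_{\ge0}$, $0$ on the empty graph, $1$ on $K_1$, additive under disjoint union, multiplicative under $\boxtimes$, monotone under $\le$. Probabilistic refinement: for a finite set $X$, $\mathcal{P}(X)$ is the set of probability distributions on $X$ and $\mathcal{P}_n(X)$ the set of $n$-types; for $Q\in\mathcal{P}_n(V(G))$, $G^{n}_{Q}$ is the subgraph of $G^{\boxtimes n}$ induced on the type class of $Q$ (sequences in $V(G)^n$ with empirical distribution $Q$). For $f\in\Delta(\mathcal{G},\le)$, nonempty $G$ and $Q\in\mathcal{P}(V(G))$, $f(G,Q)=\lim_{n}\sqrt[n]{f(G^{n}_{Q_n})}$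 for any sequence $Q_n\in\mathcal{P}_n(V(G))$, $Q_n\to Q$ (this limit exists and is independent of the sequence). A noncommutative graph is a subspace $S\subseteq B(\mathcal{H})$ ($\mathcal{H}$ finite-dimensional) with $I\in S$, $S^*=S$. A cohomomorphism from $T\subseteq B(\mathcal{K})$ to $S\subseteq B(\mathcal{H})$ is a finite family of linear maps $E_i:\mathcal{K}\to\mathcal{H}$ with $\sum_iE_i^*E_i=I$ and $E_i^*SE_j\subseteq T$ for all $i,j$; $T\le S$ if one exists. $\widehat{G}=\operatorname{span}\{|x\rangle\langle x'|:x\simeq x'\}\subseteq B(\mathbb{C}^{V(G)})$, $\mathcal{C}_d=\mathbb{C}I\subseteq B(\mathbb{C}^d)$. $\mathcal{A}$ is the semiring (under $\oplus,\otimes$, up to unitary isomorphism) generated by all $\widehat{G}$ and $\mathcal{C}_d$; its elements have the form $S=\bigoplus_{d=1}^r\widehat{G_d}\otimes\mathcal{C}_d$. For $f\in\Delta(\mathcal{G},\le)$, $\alpha\ge1$, $f_\alpha(S)=\sum_d f(G_d)d^\alpha$. $\Delta(\mathcal{A},\le)$ is the set of $\le$-monotone semiring homomorphisms $\mathcal{A}\to\mathbb{R}_{\ge0}$. For such $S$, let $\pi:\bigsqcup_dV(G_d)\to\{1,\dots,r\}$ send $g\in V(G_d)$ to $d$; for $Q\in\mathcal{P}(\bigsqcup_dV(G_d))$, let $Q_d$ be the normalized restriction of $Q$ to $V(G_d)$, and define $\log f_\alpha(S,Q)=H(\pi_*Q)+\sum_{d=1}^r\pi_*Q(d)\left[\log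 f(G_d,Q_d)+\alpha\log d\right]$, where $H$ is Shannon entropy and terms with $\pi_*Q(d)=0$ are omitted. *)

(* Defs.v *)
From HB Require Import structures.
From mathcomp Require Import all_boot all_order all_algebra.
From mathcomp Require Import all_classical all_reals.
From mathcomp Require Import exp sequences topology normedtype.
From mathcomp Require Import complex.
Set Implicit Arguments. Unset Strict Implicit. Unset Printing Implicit Defensive.
Import Order.TTheory GRing.Theory Num.Theory.
Import numFieldNormedType.Exports.
Local Open Scope classical_set_scope.
Local Open Scope ring_scope.

Record graph := Graph {
  gV : finType;
  gadj : rel gV;
  gadj_sym : symmetric gadj;
  gadj_irr : irreflexive gadj }.

Definition simeq (G : graph) (x y : gV G) : bool := (x == y) || gadj x y.

Definition K1 : graph := @Graph unit (fun _ _ => false) (fun _ _ => erefl) (fun _ => erefl).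

Definition dunion_adj (G H : graph) : rel (gV G + gV H) :=
  fun a b => match a, b with
             | inl x, inl y => gadj x y
             | inr x, inr y => gadj x y
             | _, _ => false end.
Lemma dunion_sym G H : symmetric (@dunion_adj G H).
Proof. by case=> x [] y //=; rewrite gadj_sym. Qed.
Lemma dunion_irr G H : irreflexive (@dunion_adj G H).
Proof. by case=> x /=; rewrite gadj_irr. Qed.
Definition dunion (G H : graph) : graph := Graph (@dunion_sym G H) (@dunion_irr G H).

Definition sprod_adj (G H : graph) : rel (gV G * gV H) :=
  fun a b => (a != b) && simeq a.1 b.1 && simeq a.2 b.2.
Lemma simeq_sym (G : graph) : symmetric (@simeq G).
Proof. by move=> x y; rewrite /simeq eq_sym gadj_sym. Qed.
Lemma sprod_sym G H : symmetric (@sprod_adj G H).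
Proof. by move=> a b; rewrite /sprod_adj eq_sym (simeq_sym a.1) (simeq_sym a.2). Qed.
Lemma sprod_irr G H : irreflexive (@sprod_adj G H).
Proof. by move=> a; rewrite /sprod_adj eqxx. Qed.
Definition sprod (G H : graph) : graph := Graph (@sprod_sym G H) (@sprod_irr G H).

(* H <= G : a homomorphism from the complement of H to the complement of G,
   i.e. a vertex map sending distinct non-adjacent pairs to distinct non-adjacent pairs *)
Definition graph_le (H G : graph) : Prop :=
  exists phi : gV H -> gV G, forall x y, x != y -> ~~ gadj x y ->
      (phi x != phi y) && ~~ gadj (phi x) (phi y).

Definition spectralG (R : realType) (f : graph -> R) : Prop :=
  (forall G, 0 <= f G) /\
  [/\ (forall G, #|gV G| = 0%N -> f G = 0),
      (forall G, #|gV G| = 1%N -> f G = 1),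
      (forall G H, f (dunion G H) = f G + f H),
      (forall G H, f (sprod G H) = f G * f H) &
      (forall G H, graph_le H G -> f H <= f G)].

Definition is_dist (R : realType) (V : finType) (Q : V -> R) : Prop :=
  (forall x, 0 <= Q x) /\ \sum_x Q x = 1.

Definition is_ntype (R : realType) (V : finType) (n : nat) (Q : V -> R) : Prop :=
  is_dist Q /\ exists k : V -> nat, forall x, Q x = (k x)%:R / n%:R.

(* G^n_Q : subgraph of the n-th strong power induced on the type class of Q *)
Definition typeclass (R : realType) (G : graph) (n : nat) (Q : gV G -> R) :=
  {x : {ffun 'I_n -> gV G} | [forall v, #|[set i | x i == v]|%:R == n%:R * Q v]}.
Definition tc_adj R G n Q : rel (@typeclass R G n Q) :=
  fun a b => (a != b) && [forall i, simeq (val a i) (val b i)].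
Lemma tc_sym R G n Q : symmetric (@tc_adj R G n Q).
Proof.
move=> a b; rewrite /tc_adj eq_sym; congr (_ && _).
by apply/forallP/forallP => H i; rewrite simeq_sym.
Qed.
Lemma tc_irr R G n Q : irreflexive (@tc_adj R G n Q).
Proof. by move=> a; rewrite /tc_adj eqxx. Qed.
Definition typegraph R G n Q : graph := Graph (@tc_sym R G n Q) (@tc_irr R G n Q).

Definition is_refine (R : realType) (f : graph -> R) (G : graph) (Q : gV G -> R) (v : R)
  : Prop :=
  forall Qn : nat -> gV G -> R,
    (forall n, is_ntype n.+1 (Qn n)) ->
    (forall x, (fun n => Qn n x) @ \oo --> Q x) ->
    (fun n => f (@typegraph R G n.+1 (Qn n)) `^ (n.+1%:R)^-1) @ \oo --> v.

Definition refine (R : realType) (f : graph -> R) (G : graph) (Q : gV G -> R) : R :=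
  xget 0 [set v | @is_refine R f G Q v].

(* an operator K -> H on C^K, C^H as a matrix indexed by (row in H, column in K) *)
Definition op (R : realType) (I J : finType) := I -> J -> R[i].
Definition opmul (R : realType) (I J K : finType) (A : op R I J) (B : op R J K) : op R I K :=
  fun p q => \sum_r A p r * B r q.
Definition opadj (R : realType) (I J : finType) (A : op R I J) : op R J I :=
  fun p q => (A q p)^*.
Definition opid (R : realType) (I : finType) : op R I I := fun p q => (p == q)%:R.

(* a noncommutative graph: a subspace of B(C^I) given by its membership predicate *)
Record ncgraph (R : realType) := NCG { ncI : finType; ncS : op R ncI ncI -> Prop }.

Definition nc_le (R : realType) (T S : ncgraph R) : Prop :=
  exists (n : nat) (E : 'I_n -> op R (ncI S) (ncI T)),
    (forall p q, \sum_i opmul (opadj (E i)) (E i) p q = @opid R (ncI T) p q) /\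
    (forall i j (X : op R (ncI S) (ncI S)),
        @ncS R S X -> @ncS R T (opmul (opadj (E i)) (opmul X (E j)))).

Definition nc_iso (R : realType) (S T : ncgraph R) : Prop :=
  exists U : op R (ncI T) (ncI S),
    (forall p q, opmul (opadj U) U p q = @opid R _ p q) /\
    (forall p q, opmul U (opadj U) p q = @opid R _ p q) /\
    (forall X : op R (ncI S) (ncI S), @ncS R S X <-> @ncS R T (opmul U (opmul X (opadj U)))).

Definition nc_oplus (R : realType) (S T : ncgraph R) : ncgraph R :=
  @NCG R (ncI S + ncI T)%type (fun X =>
    [/\ @ncS R S (fun a b => X (inl a) (inl b)),
        @ncS R T (fun a b => X (inr a) (inr b)),
        (forall a b, X (inl a) (inr b) = 0) &
        (forall a b, X (inr b) (inl a) = 0)]).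

Definition nc_otimes (R : realType) (S T : ncgraph R) : ncgraph R :=
  @NCG R (ncI S * ncI T)%type (fun X =>
    exists (n : nat) (A : 'I_n -> op R (ncI S) (ncI S)) (B : 'I_n -> op R (ncI T) (ncI T)),
      (forall k, @ncS R S (A k) /\ @ncS R T (B k)) /\
      (forall p q, X p q = \sum_k A k p.1 q.1 * B k p.2 q.2)).

(* An element S = (+)_{d=1}^r  hat(G_d) (x) C_d of A is represented by the list
   [G_1; ...; G_r]; the entry at (0-based) position d has multiplicity d.+1. *)
Definition Arep := seq graph.
Definition Ablock (s : Arep) (d : 'I_(size s)) : graph := nth K1 s d.
Definition Aidx (s : Arep) : finType := {d : 'I_(size s) & (gV (Ablock d) * 'I_d.+1)%type}.
Definition Agen (s : Arep) : finType := {d : 'I_(size s) & (gV (Ablock d) * gV (Ablock d))%type}.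

(* generator |x><x'| (x) I_d of block d *)
Definition Agenop (R : realType) (s : Arep) (k : Agen s) : op R (Aidx s) (Aidx s) :=
  fun p q => [exists i : 'I_(tag k).+1,
                (p == Tagged (fun d : 'I_(size s) => (gV (Ablock d) * 'I_d.+1)%type)
                        ((tagged k).1, i))
             && (q == Tagged (fun d : 'I_(size s) => (gV (Ablock d) * 'I_d.+1)%type)
                        ((tagged k).2, i))]%:R.

(* the noncommutative graph (+)_d hat(G_d) (x) C_d : the span of the generators
   |x><x'| (x) I_d with x ~= x' in G_d *)
Definition Areal (R : realType) (s : Arep) : ncgraph R :=
  @NCG R (Aidx s) (fun X =>
    exists c : Agen s -> R[i],
      (forall k, ~~ simeq (tagged k).1 (tagged k).2 -> c k = 0) /\
      (forall p q, X p q = \sum_k c k * Agenop R k p q)).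

(* Delta(A, <=): <=-monotone semiring homomorphisms A -> R_{>=0}
   (elements of A considered up to unitary isomorphism) *)
Definition spectralA (R : realType) (phi : Arep -> R) : Prop :=
  (forall s, 0 <= phi s) /\
  [/\ phi [::] = 0,
      phi [:: K1] = 1,
      (forall s t u, nc_iso (Areal R u) (nc_oplus (Areal R s) (Areal R t)) ->
                     phi u = phi s + phi t),
      (forall s t u, nc_iso (Areal R u) (nc_otimes (Areal R s) (Areal R t)) ->
                     phi u = phi s * phi t) &
      (forall s t, nc_le (Areal R t) (Areal R s) -> phi t <= phi s)].

Definition f_alpha (R : realType) (f : graph -> R) (alpha : R) (s : Arep) : R :=
  \sum_(d < size s) f (Ablock d) * (d.+1%:R) `^ alpha.

(* Main.v *)
(** An element [S = (+)_d hat(G_d) (x) C_d] of the semiring is a weighted graph: the disjoint union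
of the [G_d], where the vertices of [G_d] have multiplicity [d].  If the operators [E_i] witness
[T <= S], then for every vertex [x] of [T] some [E_i] has a nonzero block from the space over [x]
to the space over some vertex [w =: phi x] of [S].  Since [E_i^* S E_j] is contained in [T], these
blocks are multiples of isometries, any two of them with indistinguishable images overlap in a
scalar, and this scalar vanishes when their sources are distinguishable.  Tensor powers of the
blocks show [T^n_Q <= S^n_(phi_* Q)] for every [n]-type [Q], where [phi] does not depend on any
spectral point.  Hence [log f_alpha(T, Q) <= log f_alpha(S, phi_* Q)], likewise for [g_beta], and a
convex combination of both is the same inequality for [h_gamma].  As there are polynomially many
types, [h_gamma(T)^n <= (n+1)^|V(T)| h_gamma(S)^n], so [h_gamma] is monotone.

For an [n]-type [Q] with counts [k], supermultiplicativity of [f] on type classes identifies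
[log f(G, Q)] with [1/n sup_j (1/j) log f(type class of j k)]: on the subgraph induced by the
support of [k], any sequence of types converging to [Q] is squeezed between multiples of [k]. *)

Require Import Defs.
From HB Require Import structures.
From mathcomp Require Import all_boot all_order all_algebra.
From mathcomp Require Import all_classical all_reals.
From mathcomp Require Import exp sequences topology normedtype.
From mathcomp Require Import complex interval_inference.
From mathcomp Require Import zify ring.
Set Implicit Arguments. Unset Strict Implicit. Unset Printing Implicit Defensive.
Import Order.TTheory GRing.Theory Num.Theory.
Local Open Scope ring_scope.

(** * Finite words and their letter counts *)

Lemma exists_gt0_of_sum_gt0 (V : finType) (k : V -> nat) :
  (0 < \sum_v k v)%N -> exists v, (0 < k v)%N.
Proof.
by rewrite lt0n sum_nat_eq0 => /forallPn[v /= kv]; exists v; rewrite lt0n.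
Qed.

Section Words.
Variable V : finType.
Implicit Types (v : V) (n : nat).

Definition occurrences n (x : {ffun 'I_n -> V}) v : nat := (\sum_(i < n) (x i == v))%N.

Lemma occurrences_gt0 n (x : {ffun 'I_n -> V}) i : (0 < occurrences x (x i))%N.
Proof. by rewrite /occurrences (bigD1 i) //= eqxx. Qed.

Lemma sum_occurrences n (x : {ffun 'I_n -> V}) : (\sum_v occurrences x v = n)%N.
Proof.
rewrite /occurrences exchange_big /= -[RHS]card_ord -sum1_card; apply: eq_bigr => i _.
by rewrite (big_only1 (x i)) ?eqxx // => v /negbTE; rewrite eq_sym => ->.
Qed.

Definition word_cat n n' (x : {ffun 'I_n -> V}) (y : {ffun 'I_n' -> V}) :
    {ffun 'I_(n + n') -> V} :=
  [ffun i => match fintype.split i with inl j => x j | inr j => y j end].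

Lemma word_cat_lshift n n' (x : {ffun 'I_n -> V}) (y : {ffun 'I_n' -> V}) i :
  word_cat x y (lshift n' i) = x i.
Proof. by rewrite ffunE (unsplitK (inl i)). Qed.

Lemma word_cat_rshift n n' (x : {ffun 'I_n -> V}) (y : {ffun 'I_n' -> V}) i :
  word_cat x y (rshift n i) = y i.
Proof. by rewrite ffunE (unsplitK (inr i)). Qed.

Lemma word_cat_surj n n' (z : {ffun 'I_(n + n') -> V}) : exists x y, word_cat x y = z.
Proof.
exists [ffun i => z (lshift n' i)], [ffun i => z (rshift n i)].
by apply/ffunP => j; rewrite -[j]splitK ffunE unsplitK; case: fintype.split => i; rewrite ffunE.
Qed.

Lemma occurrences_cat n n' (x : {ffun 'I_n -> V}) (y : {ffun 'I_n' -> V}) v :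
  occurrences (word_cat x y) v = (occurrences x v + occurrences y v)%N.
Proof.
by rewrite /occurrences big_split_ord; congr (_ + _)%N; apply: eq_bigr => i _;
  rewrite ?word_cat_lshift ?word_cat_rshift.
Qed.

Lemma exists_word n (k : V -> nat) :
  (\sum_v k v = n)%N -> exists x : {ffun 'I_n -> V}, forall v, occurrences x v = k v.
Proof.
elim: n k => [|n IHn] k sum_k.
  have noV (i : 'I_0) : V by case: i.
  exists [ffun i => noV i] => v; rewrite /occurrences big_ord0.
  by apply/esym/eqP; move/eqP: sum_k; rewrite sum_nat_eq0 => /forallP /(_ v).
have [|v0 k_v0] := @exists_gt0_of_sum_gt0 V k; first by rewrite sum_k.
have k_split v : k v = ((v0 == v) + (k v - (v0 == v)))%N.
  by rewrite subnKC //; case: eqP => // <-.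
have [|x occ_x] := IHn (fun v => k v - (v0 == v))%N.
  apply/eqP; rewrite -eqSS -sum_k [in eqbRHS](eq_bigr _ (fun v _ => k_split v)) big_split /=.
  by rewrite [X in _ == (X + _)%N](big_only1 v0) ?eqxx // => v /negbTE; rewrite eq_sym => ->.
pose x0 : {ffun 'I_1 -> V} := [ffun=> v0].
exists (word_cat x0 x) => v; rewrite (occurrences_cat x0 x v).
by rewrite occ_x {1}/occurrences big_ord1 ffunE -k_split.
Qed.

End Words.

Definition push_counts (V W : finType) (phi : V -> W) (k : V -> nat) (w : W) : nat :=
  (\sum_(v | phi v == w) k v)%N.

Lemma sum_push_counts (V W : finType) (phi : V -> W) (k : V -> nat) :
  (\sum_w push_counts phi k w = \sum_v k v)%N.
Proof. by rewrite /push_counts [RHS](partition_big phi xpredT). Qed.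

Lemma push_countsM (V W : finType) (phi : V -> W) (k : V -> nat) j :
  push_counts phi (fun v => j * k v)%N = (fun w => j * push_counts phi k w)%N.
Proof. by apply/funext => w; rewrite /push_counts big_distrr. Qed.

Lemma occurrences_map (V W : finType) (phi : V -> W) n (x : {ffun 'I_n -> V}) w :
  occurrences [ffun i => phi (x i)] w = push_counts phi (occurrences x) w.
Proof.
rewrite /push_counts /occurrences exchange_big /=; apply: eq_bigr => i _; rewrite ffunE.
have [xw|xw] := eqVneq (phi (x i)) w.
  by rewrite (big_only1 (x i)) ?xw ?eqxx // => v /negbTE; rewrite eq_sym => ->.
by rewrite big1 // => v /eqP vw; case: eqP => // xv; rewrite xv vw eqxx in xw.
Qed.

(** * Graphs *)

Section Graphs.
Implicit Types G H : graph.

Lemma simeqxx G (x : gV G) : simeq x x.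
Proof. by rewrite /simeq eqxx. Qed.

Definition reflects_simeq G H (phi : gV G -> gV H) : Prop :=
  forall x y, simeq (phi x) (phi y) -> simeq x y.

Lemma graph_le_reflects_simeq G H (phi : gV G -> gV H) : reflects_simeq phi -> graph_le G H.
Proof.
move=> phiP; exists phi => x y xy nxy; rewrite -negb_or; apply/negP => phi_xy.
by have := phiP x y phi_xy; rewrite /simeq (negbTE xy) (negbTE nxy).
Qed.

Lemma simeq_sprod G H (a b : gV (sprod G H)) :
  simeq a b = simeq a.1 b.1 && simeq a.2 b.2.
Proof. by rewrite {1}/simeq /= /sprod_adj; case: eqP => //= ->; rewrite !simeqxx. Qed.

Section Induced.
Variables (G : graph) (P : pred (gV G)).

Definition induced_adj : rel {x | P x} := fun a b => gadj (val a) (val b).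

Lemma induced_adj_sym : symmetric induced_adj.
Proof. by move=> a b; rewrite /induced_adj gadj_sym. Qed.

Lemma induced_adj_irr : irreflexive induced_adj.
Proof. by move=> a; rewrite /induced_adj gadj_irr. Qed.

Definition induced : graph := Graph induced_adj_sym induced_adj_irr.

Lemma simeq_induced (a b : gV induced) : simeq a b = simeq (val a) (val b).
Proof. by rewrite /simeq /= /induced_adj val_eqE. Qed.

End Induced.

Section GraphOfRel.
Variables (V : finType) (r : rel V).
Hypotheses (r_refl : reflexive r) (r_sym : symmetric r).

Definition offdiag : rel V := fun a b => (a != b) && r a b.

Lemma offdiag_sym : symmetric offdiag.
Proof. by move=> a b; rewrite /offdiag eq_sym r_sym. Qed.

Lemma offdiag_irr : irreflexive offdiag.
Proof. by move=> a; rewrite /offdiag eqxx. Qed.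

Definition graph_of_rel : graph := Graph offdiag_sym offdiag_irr.

Lemma simeq_graph_of_rel (a b : gV graph_of_rel) : simeq a b = r a b.
Proof. by rewrite /simeq /= /offdiag; case: eqP => //= ->; rewrite r_refl. Qed.

End GraphOfRel.

Section Power.
Variables (G : graph) (n : nat).

Definition pow_rel : rel {ffun 'I_n -> gV G} := fun a b => [forall i, simeq (a i) (b i)].

Lemma pow_rel_refl : reflexive pow_rel.
Proof. by move=> a; apply/forallP => i; rewrite simeqxx. Qed.

Lemma pow_rel_sym : symmetric pow_rel.
Proof. by move=> a b; apply/eq_forallb => i; rewrite simeq_sym. Qed.

Definition gpow : graph := graph_of_rel pow_rel_sym.

Lemma simeq_gpow (a b : {ffun 'I_n -> gV G}) :
  @simeq gpow a b = [forall i, simeq (a i) (b i)].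
Proof. exact: simeq_graph_of_rel pow_rel_refl _ _ _. Qed.

End Power.

Lemma simeq_word_cat G n n' (x y : gV (sprod (gpow G n) (gpow G n'))) :
  @simeq (gpow G (n + n')) (word_cat x.1 x.2) (word_cat y.1 y.2) = simeq x y.
Proof.
rewrite simeq_sprod !simeq_gpow; apply/forallP/andP => [xy|[/forallP xy1 /forallP xy2] j].
  split; apply/forallP => i.
    by have := xy (lshift n' i); rewrite !word_cat_lshift.
  by have := xy (rshift n i); rewrite !word_cat_rshift.
by rewrite -[j]splitK !ffunE unsplitK; case: fintype.split.
Qed.

Lemma simeq_gpow1 G (x y : gV G) : @simeq (gpow G 1) [ffun=> x] [ffun=> y] = simeq x y.
Proof.
by rewrite simeq_gpow; apply/forallP/idP => [/(_ ord0)|xy i]; rewrite !ffunE.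
Qed.

Definition has_counts G n (k : gV G -> nat) : pred (gV (gpow G n)) :=
  fun x => [forall v, occurrences x v == k v].

Definition count_class G n (k : gV G -> nat) : graph := induced (@has_counts G n k).

End Graphs.

(** * Spectral points of graphs *)

Section SpectralPoint.
Variables (R : realType) (f : graph -> R).
Hypothesis f_spectral : spectralG f.
Implicit Types G H : graph.

Lemma spectral_ge0 G : 0 <= f G.
Proof. by case: f_spectral. Qed.

Lemma spectral_card0 G : #|gV G| = 0%N -> f G = 0.
Proof. by case: f_spectral => _ [f0 _ _ _ _]; exact: f0. Qed.

Lemma spectral_card1 G : #|gV G| = 1%N -> f G = 1.
Proof. by case: f_spectral => _ [_ f1 _ _ _]; exact: f1. Qed.

Lemma spectral_dunion G H : f (dunion G H) = f G + f H.
Proof. by case: f_spectral => _ []. Qed.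

Lemma spectral_sprod G H : f (sprod G H) = f G * f H.
Proof. by case: f_spectral => _ []. Qed.

Lemma spectral_le G H (phi : gV G -> gV H) : reflects_simeq phi -> f G <= f H.
Proof.
by case: f_spectral => _ [_ _ _ _ f_mono] /graph_le_reflects_simeq /f_mono.
Qed.

(* The map need not be injective: blowing up vertices into cliques preserves [f]. *)
Lemma spectral_eq G H (phi : gV G -> gV H) :
  (forall y, exists x, phi x = y) -> {mono phi : x y / simeq x y} -> f G = f H.
Proof.
move=> phi_surj phi_mono; have [psi psiK] := choice phi_surj.
apply/eqP; rewrite eq_le; apply/andP; split.
  by apply: (spectral_le (phi := phi)) => x y; rewrite phi_mono.
by apply: (spectral_le (phi := psi)) => x y; rewrite -phi_mono !psiK.
Qed.

Lemma spectral_ge1 G (x : gV G) : 1 <= f G.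
Proof.
rewrite -(@spectral_card1 K1) ?card_unit //.
by apply: (spectral_le (phi := fun=> x : gV G)) => -[] [].
Qed.

Lemma spectral_gpow G n : f (gpow G n) = f G ^+ n.
Proof.
elim: n => [|n IHn]; first by rewrite spectral_card1 // card_ffun card_ord.
pose cat (x : gV (sprod (gpow G 1) (gpow G n))) : gV (gpow G (1 + n)) := word_cat x.1 x.2.
rewrite -[LHS](@spectral_eq _ _ cat) => [|z|x y]; last exact: simeq_word_cat.
  rewrite spectral_sprod IHn exprS; congr (_ * _); apply/esym.
  apply: (spectral_eq (phi := fun v => [ffun=> v] : gV (gpow G 1))) => [x|x y].
    by exists ((x : {ffun 'I_1 -> gV G}) ord0); apply/ffunP => i; rewrite ffunE (ord1 i).
  exact: simeq_gpow1.
by have [x [y <-]] := word_cat_surj (z : {ffun 'I_(1 + n) -> gV G}); exists (x, y).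
Qed.

Section InducedSubgraphs.
Variables G H : graph.
Implicit Types (P Q : pred (gV G)).

Lemma spectral_induced_le P (P' : pred (gV H)) (phi : gV G -> gV H) :
  (forall x, P x -> P' (phi x)) ->
  (forall x y, P x -> P y -> simeq (phi x) (phi y) -> simeq x y) ->
  f (induced P) <= f (induced P').
Proof.
move=> PP' phiP.
pose psi (x : gV (induced P)) : gV (induced P') := exist _ (phi (val x)) (PP' _ (valP x)).
by apply: (spectral_le (phi := psi)) => x y; rewrite !simeq_induced; apply: phiP; apply: valP.
Qed.

Lemma spectral_induced_eq P (P' : pred (gV H)) (phi : gV G -> gV H) :
  (forall x, P' (phi x) = P x) -> (forall y, P' y -> exists x, phi x = y) ->
  {mono phi : x y / simeq x y} ->
  f (induced P) = f (induced P').
Proof.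
move=> phiP phi_surj phi_mono.
have phi_in (x : gV (induced P)) : P' (phi (val x)) by rewrite phiP (valP x).
pose psi (x : gV (induced P)) : gV (induced P') := exist _ (phi (val x)) (phi_in x).
apply: (spectral_eq (phi := psi)).
  case=> y P'y; have [x xy] := phi_surj y P'y; have Px : P x by rewrite -phiP xy.
  by exists (exist _ x Px); apply: val_inj.
by move=> x y; rewrite !simeq_induced phi_mono.
Qed.

Lemma spectral_inducedT P : (forall x, P x) -> f (induced P) = f G.
Proof.
move=> PT; apply: (spectral_eq (phi := val : gV (induced P) -> gV G)) => [x|x y].
  by exists (exist _ x (PT x)).
by rewrite simeq_induced.
Qed.

Lemma spectral_induced0 P : (forall x, ~~ P x) -> f (induced P) = 0.
Proof.
by move=> P0; apply: spectral_card0; apply: eq_card0 => -[x Px]; have := P0 x; rewrite Px.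
Qed.

Lemma spectral_induced_sprod P (P' : pred (gV H)) :
  f (@induced (sprod G H) (fun v => P v.1 && P' v.2)) = f (induced P) * f (induced P').
Proof.
rewrite -spectral_sprod; apply/esym.
have PP' (x : gV (sprod (induced P) (induced P'))) : P (val x.1) && P' (val x.2).
  by rewrite (valP x.1) (valP x.2).
pose phi (x : gV (sprod (induced P) (induced P'))) :
    gV (@induced (sprod G H) (fun v => P v.1 && P' v.2)) := exist _ (val x.1, val x.2) (PP' x).
apply: (spectral_eq (phi := phi)).
  case=> -[x y] /[dup] /andP[Px P'y] Pxy.
  by exists (exist _ x Px, exist _ y P'y); apply: val_inj.
by move=> x y; rewrite simeq_induced !simeq_sprod !simeq_induced.
Qed.

Lemma spectral_induced_split P Q : (forall x y, simeq x y -> Q x = Q y) ->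
  f (induced P) = f (induced (fun x => P x && Q x)) + f (induced (fun x => P x && ~~ Q x)).
Proof.
move=> Q_simeq; rewrite -spectral_dunion; apply/esym.
set U := dunion _ _.
have PQ (z : gV U) : P (match z with inl x => val x | inr x => val x end).
  by case: z => -[x /= /andP[]].
pose phi (z : gV U) : gV (induced P) := exist P _ (PQ z).
apply: (spectral_eq (phi := phi)) => [[x Px]|].
  have [Qx|nQx] := boolP (Q x).
    have PQx : P x && Q x by apply/andP.
    by exists (inl (exist _ x PQx)); apply: val_inj.
  have PnQx : P x && ~~ Q x by apply/andP.
  by exists (inr (exist _ x PnQx)); apply: val_inj.
case=> x [] y; rewrite simeq_induced /=.
- by rewrite -simeq_induced.
- have /andP[_ Qx] := valP x; have /andP[_ Qy] := valP y.
  by apply/negbTE/negP => /Q_simeq; rewrite Qx (negbTE Qy).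
- have /andP[_ Qx] := valP x; have /andP[_ Qy] := valP y.
  by apply/negbTE/negP => /Q_simeq; rewrite Qy (negbTE Qx).
- by rewrite -simeq_induced.
Qed.

End InducedSubgraphs.

Lemma eq_spectral_induced G (P P' : pred (gV G)) : P =1 P' -> f (induced P) = f (induced P').
Proof. by move=> /funext ->. Qed.

Lemma spectral_induced_partition G (P : pred (gV G)) (K : finType) (cls : gV G -> K) :
  (forall x y, simeq x y -> cls x = cls y) ->
  f (induced P) = \sum_k f (induced (fun x => P x && (cls x == k))).
Proof.
move=> cls_simeq; rewrite -big_enum.
have -> : f (induced P) = f (induced (fun x => P x && (cls x \in enum K))).
  by apply: eq_spectral_induced => x; rewrite mem_enum andbT.
elim: (enum K) (enum_uniq K) => [_|k r IHr /andP[kr /IHr]].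
  by rewrite big_nil spectral_induced0 // => x; rewrite andbF.
rewrite big_cons => <-.
rewrite (spectral_induced_split _ (Q := fun x => cls x == k)) => [|x y /cls_simeq -> //].
by congr (_ + _); apply: eq_spectral_induced => x; rewrite /= inE -andbA;
  case: eqP => [->|_]; rewrite ?(negbTE kr) ?andbF ?andbT.
Qed.

(* Deleting the edges of [G] between different classes can only increase [f]. *)
Lemma spectral_induced_partition_le G (P : pred (gV G)) (K : finType) (cls : gV G -> K) :
  f (induced P) <= \sum_k f (induced (fun x => P x && (cls x == k))).
Proof.
pose r : rel (gV G) := fun x y => simeq x y && (cls x == cls y).
have r_refl : reflexive r by move=> x; rewrite /r simeqxx eqxx.
have r_sym : symmetric r by move=> x y; rewrite /r simeq_sym eq_sym.
pose H := graph_of_rel r_sym; have simeqH (x y : gV H) : simeq x y = r x y.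
  exact: simeq_graph_of_rel.
apply: (@le_trans _ _ (f (@induced H P))).
  apply: (spectral_induced_le (phi := id : gV G -> gV H)) => // x y _ _.
  by rewrite simeqH => /andP[].
rewrite (@spectral_induced_partition H P K cls) => [|x y]; last first.
  by rewrite simeqH => /andP[_ /eqP].
apply: ler_sum => k _; apply: (spectral_induced_le (phi := id : gV H -> gV G)) => // x y.
by move=> /andP[_ /eqP xk] /andP[_ /eqP yk]; rewrite simeqH /r xk yk eqxx andbT.
Qed.

End SpectralPoint.

(** * Growth rates of superadditive functions *)

Lemma exists_gt_mulr_lt (R : realFieldType) (x q u : R) :
  0 <= x -> q * x < u -> exists2 t, q < t & t * x < u.
Proof.
move=> x0 qxu; have x1 : 0 < x + 1 by rewrite ltr_wpDl.
exists (q + (u - q * x) / (x + 1)); first by rewrite ltrDl divr_gt0 ?subr_gt0.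
by rewrite mulrDl -ltrBrDl mulrAC ltr_pdivrMr // ltr_pM2l ?subr_gt0 // ltrDl.
Qed.

Section Growth.
Import numFieldNormedType.Exports.
Local Open Scope classical_set_scope.
Variables (R : realType) (V : finType) (a : (V -> nat) -> R) (B : R).
Hypothesis a_ge0 : forall k, 0 <= a k.
Hypothesis a_superadd : forall k k', a k + a k' <= a (fun v => k v + k' v)%N.
Hypothesis a_linear_bound : forall k, a k <= B * (\sum_v k v)%:R.

Definition growth (k : V -> nat) : R :=
  sup [set x | exists j : nat, x = a (fun v => j.+1 * k v)%N / j.+1%:R].

Lemma superadditive_homo k k' : (forall v, k v <= k' v)%N -> a k <= a k'.
Proof.
move=> kk'; have -> : k' = (fun v => k v + (k' v - k v))%N.
  by apply/funext => v; rewrite subnKC.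
by apply: le_trans (a_superadd _ _); rewrite lerDl.
Qed.

Lemma superadditive_muln i k : i%:R * a k <= a (fun v => i * k v)%N.
Proof.
elim: i => [|i IHi]; first by rewrite mul0r.
rewrite -natr1 mulrDl mul1r.
under eq_fun do rewrite mulSn addnC.
by apply: le_trans (a_superadd _ _); rewrite lerD2r.
Qed.

Lemma growth_has_sup k :
  has_sup [set x | exists j : nat, x = a (fun v => j.+1 * k v)%N / j.+1%:R].
Proof.
split; first by eexists; exists 0%N.
exists (B * (\sum_v k v)%:R) => _ [j ->].
by rewrite ler_pdivrMr ?ltr0n // -mulrA -natrM mulnC big_distrr /=.
Qed.

Lemma le_growth_muln j k : a (fun v => j.+1 * k v)%N <= j.+1%:R * growth k.
Proof.
rewrite mulrC -ler_pdivrMr ?ltr0n //.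
by apply: (sup_upper_bound (growth_has_sup k)); exists j.
Qed.

Lemma le_growth k : a k <= growth k.
Proof. by have := le_growth_muln 0 k; rewrite mul1r; under eq_fun do rewrite mul1n. Qed.

Lemma growth_le k x : (forall j, a (fun v => j.+1 * k v)%N <= j.+1%:R * x) -> growth k <= x.
Proof.
move=> a_le; apply: ge_sup; first by case: (growth_has_sup k).
by move=> _ [j ->]; rewrite ler_pdivrMr ?ltr0n // mulrC.
Qed.

Lemma growth_adherent k u : u < growth k ->
  exists j : nat, u < a (fun v => j.+1 * k v)%N / j.+1%:R.
Proof.
rewrite -subr_gt0 => /sup_adherent /(_ (growth_has_sup k))[_ [j ->]].
by rewrite subKr; exists j.
Qed.

Lemma growth_ge0 k : 0 <= growth k.
Proof. exact: le_trans (a_ge0 k) (le_growth k). Qed.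

Lemma superadditive_le_growth t k k' : 0 <= t ->
  (forall v, (k' v)%:R <= t * (k v)%:R) -> a k' <= (t + 1) * growth k.
Proof.
move=> t0 k't; have /andP[t_ge t_lt] := truncn_itv t0; set i := Num.truncn t in t_ge t_lt.
apply: (@le_trans _ _ (i.+1%:R * growth k)); last first.
  by rewrite ler_wpM2r ?growth_ge0 // -natr1 lerD2r.
apply: le_trans (le_growth_muln i k); apply: superadditive_homo => v.
by rewrite -(ler_nat R) natrM (le_trans (k't v)) // ler_wpM2r // ltW.
Qed.

Lemma superadditive_ge t k k' :
  (forall v, t * (k v)%:R <= (k' v)%:R) -> (t - 1) * a k <= a k'.
Proof.
move=> k't; have [t1|/ltW t1] := leP t 1.
  by apply: le_trans (a_ge0 k'); rewrite mulr_le0_ge0 // subr_le0.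
have /andP[t_ge t_lt] := truncn_itv (le_trans ler01 t1); set i := Num.truncn t in t_ge t_lt.
apply: (@le_trans _ _ (i%:R * a k)); first by rewrite ler_wpM2r // lerBlDr natr1 ltW.
apply: le_trans (superadditive_muln i k) (superadditive_homo _) => v.
by rewrite -(ler_nat R) natrM (le_trans _ (k't v)) // ler_wpM2r.
Qed.

Lemma near_divn_lt (x u : R) : 0 < u -> \forall n \near \oo, x / n.+1%:R < u.
Proof.
move=> u0; have : x * n.+1%:R^-1 @[n --> \oo] --> x * 0.
  by apply: cvgM; [exact: cvg_cst|exact: cvg_harmonic].
by rewrite mulr0 => /cvgr_lt; apply.
Qed.

Section Limit.
Variables (k : V -> nat) (q : R) (kn : nat -> V -> nat).
Hypotheses (k_gt0 : forall v, (0 < k v)%N) (q_gt0 : 0 < q).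
Hypothesis kn_cvg : forall v, (kn n v)%:R / n.+1%:R @[n --> \oo] --> q * (k v)%:R.

Lemma superadditive_limsup u :
  q * growth k < u -> \forall n \near \oo, a (kn n) / n.+1%:R < u.
Proof.
move=> /(exists_gt_mulr_lt (growth_ge0 k))[t qt tu]; near=> n.
have n0 : 0 < n.+1%:R :> R by rewrite ltr0n.
apply: (@le_lt_trans _ _ (t * growth k + growth k / n.+1%:R)); last first.
  by rewrite -ltrBrDl; near: n; apply: near_divn_lt; rewrite subr_gt0.
have -> : t * growth k + growth k / n.+1%:R = (t * n.+1%:R + 1) * growth k / n.+1%:R.
  by field; rewrite gt_eqF.
rewrite ler_pM2r ?invr_gt0 //; apply: superadditive_le_growth => [|v].
  by rewrite mulr_ge0 // ltW // (lt_trans q_gt0).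
rewrite mulrAC -ler_pdivrMr //; move: v; near: n; apply: filter_forall => v.
by apply: (cvgr_le _ (@kn_cvg v)); rewrite ltr_pM2r ?ltr0n.
Unshelve. all: by end_near. Qed.

Lemma superadditive_liminf u :
  u < q * growth k -> \forall n \near \oo, u < a (kn n) / n.+1%:R.
Proof.
rewrite mulrC -ltr_pdivrMr // => /growth_adherent[j].
rewrite ltr_pdivrMr // mulrC; set A := a _ => u_lt_A; have j0 : 0 < j.+1%:R :> R by rewrite ltr0n.
have [||t qt tu] := @exists_gt_mulr_lt _ (A / j.+1%:R) (- q) (- u).
- by rewrite divr_ge0 ?a_ge0.
- by rewrite mulNr ltrN2.
near=> n; have n0 : 0 < n.+1%:R :> R by rewrite ltr0n.
apply: (@lt_le_trans _ _ (- t * (A / j.+1%:R) - A / n.+1%:R)).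
  rewrite ltrBrDr addrC -ltrBrDr; near: n; apply: near_divn_lt.
  by rewrite subr_gt0 mulNr ltrNr.
have -> : - t * (A / j.+1%:R) - A / n.+1%:R = (- t * n.+1%:R / j.+1%:R - 1) * A / n.+1%:R.
  by field; rewrite !gt_eqF.
rewrite ler_pM2r ?invr_gt0 //; apply: superadditive_ge => v.
rewrite natrM mulrA divfK ?gt_eqF // mulrAC -ler_pdivlMr //.
move: v; near: n; apply: filter_forall => v.
by apply: (cvgr_ge _ (@kn_cvg v)); rewrite ltr_pM2r ?ltr0n // ltrNl.
Unshelve. all: by end_near. Qed.

Lemma superadditive_cvg : a (kn n) / n.+1%:R @[n --> \oo] --> q * growth k.
Proof.
apply/cvgrPdist_lt => e e0; near=> n; rewrite ltr_distlC; apply/andP; split; near: n.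
  by apply: superadditive_liminf; rewrite ltrBlDr ltrDl.
by apply: superadditive_limsup; rewrite ltrDl.
Unshelve. all: by end_near. Qed.

End Limit.

End Growth.

(** * Probabilistic refinement as a growth rate *)

Lemma ln_exprn (R : realType) (x : R) n : 0 < x -> ln (x ^+ n) = n%:R * ln x.
Proof. by move=> x0; rewrite lnXn // mulr_natl. Qed.

Lemma ln_le_of_le_exprn (R : realType) (x y : R) n :
  0 < x -> 0 <= y -> x <= y ^+ n -> ln x <= n%:R * ln y.
Proof.
move=> x0 y0; case: n => [|n] xy; first by rewrite mul0r ln_le0.
have y_gt0 : 0 < y.
  rewrite lt_neqAle y0 andbT eq_sym; apply/eqP => yE.
  by move: (lt_le_trans x0 xy); rewrite yE expr0n ltxx.
by rewrite -ln_exprn // ler_ln ?posrE ?exprn_gt0.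
Qed.

Section Ntypes.
Import numFieldNormedType.Exports.
Local Open Scope classical_set_scope.
Variables (R : realType) (V : finType) (k : V -> nat) (N : nat).
Hypotheses (sum_k : (\sum_v k v = N)%N) (N_gt0 : (0 < N)%N).

Lemma cvg_modn_div : (n.+1 %% N)%:R / n.+1%:R @[n --> \oo] --> (0 : R).
Proof.
have cvgN : N%:R * n.+1%:R^-1 @[n --> \oo] --> (0 : R).
  by rewrite -(mulr0 N%:R); apply: cvgM; [exact: cvg_cst|exact: cvg_harmonic].
apply: (squeeze_cvgr _ (cvg_cst 0) cvgN).
near=> n; rewrite divr_ge0 //= ler_pM2r ?invr_gt0 ?ltr0n //.
by rewrite ler_nat ltnW // ltn_mod.
Unshelve. all: by end_near. Qed.

Lemma cvg_divn_div : (n.+1 %/ N)%:R / n.+1%:R @[n --> \oo] --> (N%:R^-1 : R).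
Proof.
have N0 : N%:R != 0 :> R by rewrite pnatr_eq0 -lt0n.
have -> : (fun n => (n.+1 %/ N)%:R / n.+1%:R : R) =
          (fun n => N%:R^-1 * (1 - (n.+1 %% N)%:R / n.+1%:R)).
  apply/funext => n; have n0 : n.+1%:R != 0 :> R by rewrite pnatr_eq0.
  have -> : (n.+1 %% N)%:R = n.+1%:R - (n.+1 %/ N)%:R * N%:R :> R.
    by rewrite {2}(divn_eq n.+1 N) natrD natrM addrC addKr.
  by field; apply/andP.
have lim : N%:R^-1 * (1 - (n.+1 %% N)%:R / n.+1%:R) @[n --> \oo] --> (N%:R^-1 * (1 - 0) : R).
  by apply: cvgM; [exact: cvg_cst|apply: cvgB; [exact: cvg_cst|exact: cvg_modn_div]].
by move: lim; rewrite subr0 mulr1.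
Qed.

Lemma exists_counts_cvg : exists kn : nat -> V -> nat,
  (forall n, \sum_v kn n v = n.+1)%N /\
  forall v, (kn n v)%:R / n.+1%:R @[n --> \oo] --> (N%:R^-1 * (k v)%:R : R).
Proof.
have [|v0 _] := @exists_gt0_of_sum_gt0 V k; first by rewrite sum_k.
exists (fun n v => n.+1 %/ N * k v + (v == v0) * (n.+1 %% N))%N; split=> [n|v].
  rewrite big_split /= -big_distrr /= sum_k -big_distrl /=.
  by rewrite (big_only1 v0) ?eqxx // => [|v /negbTE -> //]; rewrite mul1n -divn_eq.
have -> : (fun n => (n.+1 %/ N * k v + (v == v0) * (n.+1 %% N))%:R / n.+1%:R : R) =
    (fun n => (n.+1 %/ N)%:R / n.+1%:R * (k v)%:R + (v == v0)%:R * ((n.+1 %% N)%:R / n.+1%:R)).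
  by apply/funext => n; rewrite natrD !natrM mulrDl mulrA mulrAC.
have lim : (n.+1 %/ N)%:R / n.+1%:R * (k v)%:R + (v == v0)%:R * ((n.+1 %% N)%:R / n.+1%:R)
    @[n --> \oo] --> (N%:R^-1 * (k v)%:R + (v == v0)%:R * 0 : R).
  by apply: cvgD; apply: cvgM;
    [exact: cvg_divn_div|exact: cvg_cst|exact: cvg_cst|exact: cvg_modn_div].
by move: lim; rewrite mulr0 addr0.
Qed.

End Ntypes.

Section Refinement.
Import numFieldNormedType.Exports.
Local Open Scope classical_set_scope.
Variables (R : realType) (f : graph -> R).
Hypothesis f_spectral : spectralG f.
Implicit Type G : graph.

Definition log_class G (k : gV G -> nat) : R := ln (f (count_class (\sum_v k v) k)).

Definition log_refine G (k : gV G -> nat) : R := growth (@log_class G) k.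

Lemma spectral_count_class_ge1 G n (k : gV G -> nat) :
  (\sum_v k v = n)%N -> 1 <= f (count_class n k).
Proof.
move=> /exists_word[x occ_x]; have xk : @has_counts G n k x by apply/forallP => v; rewrite occ_x.
exact: (spectral_ge1 f_spectral (exist _ x xk : gV (count_class n k))).
Qed.

Lemma spectral_count_class_gt0 G n (k : gV G -> nat) :
  (\sum_v k v = n)%N -> 0 < f (count_class n k).
Proof. by move=> /spectral_count_class_ge1; apply: lt_le_trans. Qed.

Lemma spectral_count_class_le G n (k : gV G -> nat) : f (count_class n k) <= f G ^+ n.
Proof.
rewrite -spectral_gpow //.
exact: (spectral_le f_spectral (phi := val : gV (count_class n k) -> gV (gpow G n))).
Qed.

Lemma spectral_count_class_mul_le G n n' (k k' : gV G -> nat) :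
  f (count_class n k) * f (count_class n' k') <=
  f (count_class (n + n') (fun v => k v + k' v)%N).
Proof.
rewrite -spectral_induced_sprod //.
pose cat (x : gV (sprod (gpow G n) (gpow G n'))) : gV (gpow G (n + n')) := word_cat x.1 x.2.
apply: (spectral_induced_le f_spectral (phi := cat)) => [x|x y _ _].
  move=> /andP[/forallP xk /forallP xk']; apply/forallP => v.
  by rewrite occurrences_cat (eqP (xk v)) (eqP (xk' v)).
by rewrite simeq_word_cat.
Qed.

Lemma log_class_ge0 G (k : gV G -> nat) : 0 <= log_class k.
Proof. by apply: ln_ge0; apply: spectral_count_class_ge1. Qed.

Lemma log_class_superadd G (k k' : gV G -> nat) :
  log_class k + log_class k' <= log_class (fun v => k v + k' v)%N.
Proof.
rewrite /log_class -lnM ?posrE ?spectral_count_class_gt0 //.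
rewrite ler_ln ?posrE ?mulr_gt0 ?spectral_count_class_gt0 //.
by rewrite big_split /=; apply: spectral_count_class_mul_le.
Qed.

Lemma log_class_linear_bound G (k : gV G -> nat) :
  log_class k <= ln (f G) * (\sum_v k v)%:R.
Proof.
rewrite mulrC; apply: ln_le_of_le_exprn (spectral_count_class_le _ _).
  exact: spectral_count_class_gt0.
exact: spectral_ge0.
Qed.

Lemma card_occurrences (V : finType) n (x : {ffun 'I_n -> V}) v :
  #|[set i | x i == v]| = occurrences x v.
Proof.
rewrite -sum1_card big_mkcond /=; apply: eq_bigr => i _.
have -> : (i \in [set i | x i == v]) = (x i == v) by apply/idP/idP; rewrite in_setE.
by case: eqP.
Qed.

Lemma spectral_typegraph G n (k : gV G -> nat) :
  f (@typegraph R G n.+1 (fun v => (k v)%:R / n.+1%:R)) = f (count_class n.+1 k).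
Proof.
set T := typegraph _ _.
have typeE (x : {ffun 'I_n.+1 -> gV G}) : @has_counts G n.+1 k x =
    [forall v, #|[set i | x i == v]|%:R == n.+1%:R * ((k v)%:R / n.+1%:R) :> R].
  by apply: eq_forallb => v; rewrite mulrC divfK ?pnatr_eq0 // eqr_nat card_occurrences.
have typeP (x : gV T) : @has_counts G n.+1 k (val x) by rewrite typeE (valP x).
pose phi (x : gV T) : gV (count_class n.+1 k) := exist _ (val x) (typeP x).
apply: (spectral_eq f_spectral (phi := phi)) => [[x xk]|x y].
  have xT := xk; rewrite typeE in xT.
  by exists (exist _ x xT); apply: val_inj.
rewrite simeq_induced simeq_gpow /simeq /= /tc_adj.
by case: eqP => //= ->; apply/forallP => i; rewrite eqxx.
Qed.

Section FullSupport.
Variables (G : graph) (k : gV G -> nat) (N : nat).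
Hypotheses (k_gt0 : forall v, (0 < k v)%N) (sum_k : (\sum_v k v = N)%N) (N_gt0 : (0 < N)%N).

Lemma is_refine_growth :
  is_refine f (fun v => N%:R^-1 * (k v)%:R) (expR (N%:R^-1 * log_refine k)).
Proof.
move=> Qn Qn_type Qn_cvg.
have /choice[kn knP] n : exists k : gV G -> nat, forall x, Qn n x = (k x)%:R / n.+1%:R.
  by case: (Qn_type n).
have QnE n : Qn n = fun x => (kn n x)%:R / n.+1%:R by apply/funext => x.
have sum_kn n : (\sum_v kn n v = n.+1)%N.
  case: (Qn_type n) => -[_]; rewrite QnE -mulr_suml -natr_sum => sumQ _.
  apply/eqP; rewrite -(eqr_nat R); apply/eqP.
  by rewrite -[LHS](divfK (_ : n.+1%:R != 0)) ?pnatr_eq0 // sumQ mul1r.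
have -> : (fun n => f (@typegraph R G n.+1 (Qn n)) `^ n.+1%:R^-1) =
          (fun n => expR (log_class (kn n) / n.+1%:R)).
  apply/funext => n; rewrite QnE spectral_typegraph /log_class sum_kn.
  by rewrite /powR gt_eqF ?spectral_count_class_gt0 // mulrC.
have log_cvg : log_class (kn n) / n.+1%:R @[n --> \oo] --> N%:R^-1 * log_refine k.
  apply: (superadditive_cvg (@log_class_ge0 G) (@log_class_superadd G)
                            (@log_class_linear_bound G) k_gt0) => [|v].
    by rewrite invr_gt0 ltr0n.
  by have := @Qn_cvg v; under eq_fun do rewrite QnE.
exact: cvg_comp log_cvg (@continuous_expR R _).
Qed.

Lemma ln_refine : ln (refine f (fun v => N%:R^-1 * (k v)%:R)) = N%:R^-1 * log_refine k.
Proof.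
set Q := fun v => _.
have refineP : is_refine f Q (refine f Q).
  apply: (@xgetPex _ 0 [set v | is_refine f Q v]).
  by exists (expR (N%:R^-1 * log_refine k)); exact: is_refine_growth.
have [kn [sum_kn kn_cvg]] := exists_counts_cvg R sum_k N_gt0.
pose Qn n (v : gV G) : R := (kn n v)%:R / n.+1%:R.
have Qn_type n : is_ntype n.+1 (Qn n).
  split; last by exists (kn n).
  split; first by move=> x; rewrite divr_ge0.
  by rewrite -mulr_suml -natr_sum sum_kn divff // pnatr_eq0.
have lim1 := refineP Qn Qn_type kn_cvg; have lim2 := is_refine_growth Qn_type kn_cvg.
by rewrite (cvg_unique (@norm_hausdorff _ _) lim1 lim2) expRK.
Qed.

End FullSupport.

Section Support.
Variables (G : graph) (P : pred (gV G)) (k : gV G -> nat).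
Hypothesis k_supp : forall v, (0 < k v)%N -> P v.

Lemma sum_induced_counts : (\sum_(v : gV (induced P)) k (val v) = \sum_v k v)%N.
Proof.
rewrite [RHS](bigID P) /= [X in (_ = _ + X)%N]big1 ?addn0.
  by rewrite (big_sub P k).
by move=> v; apply: contraNeq; rewrite -lt0n; apply: k_supp.
Qed.

Lemma spectral_count_class_induced n :
  f (@count_class (induced P) n (fun v => k (val v))) = f (count_class n k).
Proof.
pose phi (x : gV (gpow (induced P) n)) : gV (gpow G n) :=
  [ffun i => val ((x : {ffun _ -> _}) i)].
have occ_phi x (v : gV (induced P)) :
    occurrences (phi x : {ffun _ -> _}) (val v) = occurrences (x : {ffun _ -> _}) v.
  by apply: eq_bigr => i _; rewrite ffunE val_eqE.
apply: (spectral_induced_eq f_spectral (phi := phi)) => [x|y /forallP yk|x y].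
- apply/forallP/forallP => [xk v|xk v]; first by rewrite -occ_phi xk.
  have [Pv|nPv] := boolP (P v); first by rewrite (occ_phi x (exist _ v Pv)) (xk (exist _ v Pv)).
  have -> : k v = 0%N by apply/eqP; rewrite -leqn0 leqNgt; apply: contra nPv => /k_supp.
  rewrite /occurrences big1 // => i _; rewrite ffunE; apply/eqP; rewrite eqb0.
  by apply: contra nPv => /eqP <-; apply: valP.
- have Py i : P ((y : {ffun _ -> _}) i).
    by apply: k_supp; rewrite -(eqP (yk _)) occurrences_gt0.
  exists [ffun i => exist _ ((y : {ffun _ -> _}) i) (Py i)].
  by apply/ffunP => i; rewrite !ffunE.
- rewrite !simeq_gpow; apply: eq_forallb => i.
  by rewrite !ffunE simeq_induced.
Qed.

End Support.

Lemma log_refine_induced G (P : pred (gV G)) (k : gV G -> nat) :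
  (forall v, (0 < k v)%N -> P v) ->
  @log_refine (induced P) (fun v => k (val v)) = log_refine k.
Proof.
move=> k_supp; rewrite /log_refine /growth; congr (sup _); apply/seteqP.
have logE j : @log_class (induced P) (fun v => j.+1 * k (val v))%N =
              log_class (fun v => j.+1 * k v)%N.
  have jk_supp v : (0 < j.+1 * k v)%N -> P v by rewrite muln_gt0 => /k_supp.
  by rewrite /log_class (sum_induced_counts jk_supp) (spectral_count_class_induced jk_supp).
by split=> x /= -[j ->]; exists j; rewrite logE.
Qed.

End Refinement.

Definition refine_convex_comb (R : realType) (lambda : R) (f g h : graph -> R) : Prop :=
  forall (G : graph) (P : gV G -> R), (0 < #|gV G|)%N -> is_dist P ->
  ln (refine h P) = lambda * ln (refine f P) + (1 - lambda) * ln (refine g P).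

Lemma log_refine_convex_comb (R : realType) (lambda : R) (f g h : graph -> R) :
  spectralG f -> spectralG g -> spectralG h -> refine_convex_comb lambda f g h ->
  forall (G : graph) (k : gV G -> nat), (0 < \sum_v k v)%N ->
  log_refine h k = lambda * log_refine f k + (1 - lambda) * log_refine g k.
Proof.
move=> f_spec g_spec h_spec refine_convex G k; move E : (\sum_v k v)%N => N N_gt0.
pose P : pred (gV G) := fun v => (0 < k v)%N.
have k_supp v : (0 < k v)%N -> P v by [].
rewrite -!(log_refine_induced _ k_supp) //.
have sum_k := sum_induced_counts k_supp; rewrite E in sum_k.
have k_gt0 (v : gV (induced P)) : (0 < k (val v))%N by case: v.
have := refine_convex (induced P) (fun v => N%:R^-1 * (k (val v))%:R).
rewrite !ln_refine // => ln_convex.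
have N0 : N%:R != 0 :> R by rewrite pnatr_eq0 -lt0n.
apply: (mulfI (_ : N%:R^-1 != 0)); first by rewrite invr_eq0.
rewrite mulrDr [_ * (lambda * _)]mulrCA [_ * ((1 - lambda) * _)]mulrCA; apply: ln_convex.
  rewrite lt0n; apply: contraTneq N_gt0 => V0; rewrite -sum_k big1 // => v.
  by have := card0_eq V0 v; rewrite inE.
split=> [v|]; first by rewrite mulr_ge0 ?invr_ge0.
by rewrite -mulr_sumr -natr_sum sum_k mulVf.
Qed.

(** * Weighted graphs *)

(* The vertex [v] carries the space with basis [fib v], the same one as its neighbours, so that
   [|u><v| (x) I] makes sense for [u ~= v]. *)
Record wgraph := WGraph {
  wg :> graph;
  wlabel : finType;
  fib : gV wg -> {set wlabel};
  fib_gt0 : forall v, (0 < #|fib v|)%N;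
  fib_simeq : forall u v, simeq u v -> fib u = fib v }.

Section WeightedGraphs.
Implicit Type W : wgraph.

Definition mult W (v : gV W) : nat := #|fib v|.

Section Sum.
Variables W W' : wgraph.

Definition wdunion_fib (v : gV (dunion W W')) : {set wlabel W + wlabel W'} :=
  match v with inl x => inl @: fib x | inr y => inr @: fib y end.

Lemma card_wdunion_fib v :
  #|wdunion_fib v| = match v with inl x => mult x | inr y => mult y end.
Proof. by case: v => v; rewrite card_imset //; [exact: inl_inj|exact: inr_inj]. Qed.

Lemma wdunion_fib_gt0 v : (0 < #|wdunion_fib v|)%N.
Proof. by rewrite card_wdunion_fib; case: v => v; apply: fib_gt0. Qed.

Lemma wdunion_fib_simeq u v : simeq u v -> wdunion_fib u = wdunion_fib v.
Proof.
by case: u v => u [] v //= => [/(@fib_simeq W)|/(@fib_simeq W')] ->.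
Qed.

Definition wdunion : wgraph := WGraph wdunion_fib_gt0 wdunion_fib_simeq.

End Sum.

Section Product.
Variables W W' : wgraph.

Definition wsprod_fib (v : gV (sprod W W')) : {set wlabel W * wlabel W'} :=
  finset.setX (fib v.1) (fib v.2).

Lemma wsprod_fib_gt0 v : (0 < #|wsprod_fib v|)%N.
Proof. by rewrite cardsX muln_gt0 !fib_gt0. Qed.

Lemma wsprod_fib_simeq u v : simeq u v -> wsprod_fib u = wsprod_fib v.
Proof. by rewrite simeq_sprod /wsprod_fib => /andP[/fib_simeq -> /fib_simeq ->]. Qed.

Definition wsprod : wgraph := WGraph wsprod_fib_gt0 wsprod_fib_simeq.

End Product.

Section Power.
Variables (W : wgraph) (n : nat).

Definition wpow_fib (x : gV (gpow W n)) : {set {ffun 'I_n -> wlabel W}} :=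
  [set b in family (fun i => fib ((x : {ffun _ -> _}) i))].

Lemma card_wpow_fib (x : {ffun 'I_n -> gV W}) : #|wpow_fib x| = (\prod_i mult (x i))%N.
Proof. by rewrite cardsE card_family foldrE big_map big_enum. Qed.

Lemma wpow_fib_gt0 x : (0 < #|wpow_fib x|)%N.
Proof. by rewrite card_wpow_fib prodn_gt0 // => i; apply: fib_gt0. Qed.

Lemma wpow_fib_simeq x y : simeq x y -> wpow_fib x = wpow_fib y.
Proof.
rewrite simeq_gpow => /forallP xy; apply/setP => b; rewrite !inE.
apply/familyP/familyP => b_fib i; have := b_fib i; first by rewrite (fib_simeq (xy i)).
by rewrite -(fib_simeq (xy i)).
Qed.

Definition wpow : wgraph := WGraph wpow_fib_gt0 wpow_fib_simeq.

End Power.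

Section Induced.
Variables (W : wgraph) (P : pred (gV W)).

Definition winduced_fib (v : gV (induced P)) : {set wlabel W} := fib (val v).

Lemma winduced_fib_gt0 v : (0 < #|winduced_fib v|)%N.
Proof. exact: fib_gt0. Qed.

Lemma winduced_fib_simeq u v : simeq u v -> winduced_fib u = winduced_fib v.
Proof. by rewrite simeq_induced => /fib_simeq. Qed.

Definition winduced : wgraph := WGraph winduced_fib_gt0 winduced_fib_simeq.

End Induced.

Definition wcount_class W n (k : gV W -> nat) : wgraph := @winduced (wpow W n) (@has_counts W n k).

Lemma mult_count_class W n (k : gV W -> nat) (x : {ffun 'I_n -> gV W}) :
  has_counts k x -> @mult (wpow W n) x = (\prod_v mult v ^ k v)%N.
Proof.
move=> /forallP xk; rewrite /mult card_wpow_fib (partition_big x xpredT) //=.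
apply: eq_bigr => v _; rewrite -(eqP (xk v)) (eq_bigr (fun=> mult v)) => [|i /eqP -> //].
by rewrite prod_nat_const -sum1_card big_mkcond; congr (_ ^ _)%N; apply: eq_bigr => i _;
  rewrite unfold_in; case: eqP.
Qed.

End WeightedGraphs.

(** * Values of weighted graphs *)

Definition wvalue (R : realType) (f : graph -> R) (a : R) (W : wgraph) : R :=
  \sum_(F : {set wlabel W}) f (induced (fun v : gV W => fib v == F)) * #|F|%:R `^ a.

Section Value.
Variables (R : realType) (f : graph -> R) (a : R).
Hypothesis f_spectral : spectralG f.
Implicit Type W : wgraph.

Lemma wvalue_ge0 W : 0 <= wvalue f a W.
Proof. by apply: sumr_ge0 => F _; rewrite mulr_ge0 ?spectral_ge0 ?powR_ge0. Qed.

Section Classes.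
Variables (W : wgraph) (K : finType) (cls : gV W -> K) (mu : K -> nat).
Hypothesis mu_cls : forall v, mult v = mu (cls v).

Lemma sum_fib_classes :
  \sum_F (\sum_k f (induced (fun v : gV W => (fib v == F) && (cls v == k)))) * #|F|%:R `^ a =
  \sum_k f (induced (fun v => cls v == k)) * (mu k)%:R `^ a.
Proof.
under eq_bigr do rewrite mulr_suml.
rewrite exchange_big /=; apply: eq_bigr => k _.
rewrite (spectral_induced_partition f_spectral _ (@fib_simeq W)) mulr_suml.
apply: eq_bigr => F _.
have [v /andP[/eqP vF /eqP vk]|none] := pickP (fun v : gV W => (fib v == F) && (cls v == k)).
  rewrite -vF -vk -mu_cls; congr (_ * _); apply: eq_spectral_induced => // u.
  by rewrite andbC.
by rewrite !spectral_induced0 ?mul0r // => v; rewrite ?[(cls v == k) && _]andbC;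
  apply/negbT/none.
Qed.

Lemma wvalue_le_classes :
  wvalue f a W <= \sum_k f (induced (fun v => cls v == k)) * (mu k)%:R `^ a.
Proof.
rewrite -sum_fib_classes; apply: ler_sum => F _; rewrite ler_wpM2r ?powR_ge0 //.
exact: spectral_induced_partition_le.
Qed.

Lemma wvalue_classes : (forall u v, simeq u v -> cls u = cls v) ->
  wvalue f a W = \sum_k f (induced (fun v => cls v == k)) * (mu k)%:R `^ a.
Proof.
move=> cls_simeq; rewrite -sum_fib_classes; apply: eq_bigr => F _; congr (_ * _).
exact: spectral_induced_partition.
Qed.

End Classes.

Lemma wvalue_const W D : (forall v : gV W, mult v = D) -> wvalue f a W = f W * D%:R `^ a.
Proof.
move=> multD; rewrite (@wvalue_classes W unit (fun=> tt) (fun=> D)) //.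
by rewrite (big_only1 tt) => [||[]] //; rewrite spectral_inducedT.
Qed.

Lemma wvalue_le W W' (phi : gV W -> gV W') :
  (forall v, mult (phi v) = mult v) -> reflects_simeq phi -> wvalue f a W <= wvalue f a W'.
Proof.
move=> mult_phi phiP.
apply: le_trans (@wvalue_le_classes W _ (fun v => fib (phi v)) (fun F => #|F|) _) _.
  by move=> v; rewrite -mult_phi.
apply: ler_sum => F _; rewrite ler_wpM2r ?powR_ge0 //.
by apply: (spectral_induced_le f_spectral (phi := phi)) => // x y _ _ /phiP.
Qed.

Lemma wvalue_eq W W' (phi : gV W -> gV W') :
  (forall y, exists x, phi x = y) -> (forall v, mult (phi v) = mult v) ->
  {mono phi : x y / simeq x y} -> wvalue f a W = wvalue f a W'.
Proof.
move=> phi_surj mult_phi phi_mono; have [psi psiK] := choice phi_surj.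
apply/eqP; rewrite eq_le; apply/andP; split.
  by apply: (wvalue_le (phi := phi)) => // x y; rewrite phi_mono.
apply: (wvalue_le (phi := psi)) => [v|x y]; first by rewrite -mult_phi psiK.
by rewrite -phi_mono !psiK.
Qed.

Lemma wvalue_dunion W W' : wvalue f a (wdunion W W') = wvalue f a W + wvalue f a W'.
Proof.
pose cls (v : gV (wdunion W W')) : {set wlabel W} + {set wlabel W'} :=
  match v with inl x => inl (fib x) | inr y => inr (fib y) end.
pose mu (F : {set wlabel W} + {set wlabel W'}) := match F with inl F => #|F| | inr F => #|F| end.
rewrite (@wvalue_classes _ _ cls mu) => [|v|u v]; last first.
- by case: u v => u [] v //= => [/(@fib_simeq W)|/(@fib_simeq W')] ->.
- by rewrite /mult card_wdunion_fib; case: v.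
rewrite big_sumType; congr (_ + _); apply: eq_bigr => F _; congr (_ * _); apply/esym.
  apply: (spectral_induced_eq f_spectral (phi := inl : gV W -> gV (wdunion W W'))) => // -[] //= x.
  by exists x.
apply: (spectral_induced_eq f_spectral (phi := inr : gV W' -> gV (wdunion W W'))) => // -[] //= x.
by exists x.
Qed.

Lemma wvalue_sprod W W' : wvalue f a (wsprod W W') = wvalue f a W * wvalue f a W'.
Proof.
pose cls (v : gV (wsprod W W')) := (fib v.1, fib v.2).
rewrite (@wvalue_classes _ _ cls (fun F => #|F.1| * #|F.2|)%N) => [|v|u v]; last first.
- by rewrite simeq_sprod /cls => /andP[/fib_simeq -> /fib_simeq ->].
- exact: cardsX.
rewrite /wvalue mulr_suml; under [RHS]eq_bigr do rewrite mulr_sumr.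
rewrite pair_big /=; apply: eq_bigr => -[F F'] _ /=.
by rewrite natrM powRM // mulrACA -spectral_induced_sprod.
Qed.

Lemma wvalue_pow W n : wvalue f a (wpow W n) = wvalue f a W ^+ n.
Proof.
elim: n => [|n IHn].
  rewrite (@wvalue_const _ 1%N) => [|x]; last by rewrite /mult card_wpow_fib big_ord0.
  by rewrite powR1 mulr1 spectral_card1 // card_ffun card_ord.
pose cat (x : gV (wsprod (wpow W 1) (wpow W n))) : gV (wpow W (1 + n)) := word_cat x.1 x.2.
rewrite -[LHS](@wvalue_eq _ _ cat) => [|z|x|x y]; last exact: simeq_word_cat.
- rewrite wvalue_sprod IHn exprS; congr (_ * _); apply/esym.
  apply: (wvalue_eq (phi := fun v => [ffun=> v] : gV (wpow W 1))) => [x|v|x y].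
  + by exists ((x : {ffun 'I_1 -> gV W}) ord0); apply/ffunP => i; rewrite ffunE (ord1 i).
  + by rewrite /mult card_wpow_fib big_ord1 ffunE.
  + exact: simeq_gpow1.
- by have [x [y <-]] := word_cat_surj (z : {ffun 'I_(1 + n) -> gV W}); exists (x, y).
rewrite /mult card_wpow_fib [RHS]cardsX !card_wpow_fib big_split_ord.
by congr (_ * _)%N; apply: eq_bigr => i _; rewrite ?word_cat_lshift ?word_cat_rshift.
Qed.

Lemma wvalue_wcount_class W n k :
  wvalue f a (@wcount_class W n k) = f (count_class n k) * (\prod_v mult v ^ k v)%N%:R `^ a.
Proof. by apply: wvalue_const => v; apply: mult_count_class (valP v). Qed.

Lemma wvalue_wcount_class_le W n k : wvalue f a (@wcount_class W n k) <= wvalue f a W ^+ n.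
Proof.
rewrite -wvalue_pow.
exact: (wvalue_le (phi := val : gV (@wcount_class W n k) -> gV (wpow W n))).
Qed.

Lemma wvalue_exprn_le W n : wvalue f a W ^+ n <=
  \sum_(k : {ffun gV W -> 'I_n.+1} | (\sum_v k v == n)%N)
    wvalue f a (wcount_class n (fun v => k v : nat)).
Proof.
rewrite -wvalue_pow.
pose cls (x : gV (wpow W n)) : {ffun gV W -> 'I_n.+1} :=
  [ffun v => inord (occurrences (x : {ffun _ -> _}) v)].
have clsE x v : cls x v = occurrences (x : {ffun _ -> _}) v :> nat.
  rewrite ffunE inordK // ltnS -[leqRHS](sum_occurrences (x : {ffun _ -> _})).
  by rewrite (bigD1 v) //= leq_addr.
have cls_counts x (k : {ffun gV W -> 'I_n.+1}) : (cls x == k) = has_counts (fun v => k v : nat) x.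
  apply/eqP/forallP => [<- v|xk]; first by rewrite clsE.
  by apply/ffunP => v; apply/val_inj; exact: etrans (clsE x v) (eqP (xk v)).
apply: le_trans (@wvalue_le_classes (wpow W n) _ cls
  (fun k => \prod_v mult v ^ k v)%N _) _ => [x|].
  by apply: mult_count_class; rewrite -cls_counts.
rewrite [leRHS]big_mkcond /=; apply: ler_sum => k _; case: ifPn => sum_k.
  rewrite wvalue_wcount_class (_ : induced _ = count_class n (fun v => k v : nat)) //.
  by congr induced; apply/funext => x; rewrite cls_counts.
rewrite spectral_induced0 ?mul0r // => x; apply: contra sum_k => /eqP <-.
by under eq_bigr do rewrite clsE; rewrite sum_occurrences.
Qed.

End Value.

(** * Logarithmic refinement of weighted graphs *)

Lemma ln_prod_expn (R : realType) (V : finType) (m k : V -> nat) : (forall v, 0 < m v)%N ->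
  ln (\prod_v m v ^ k v)%N%:R = \sum_v (k v)%:R * ln (m v)%:R :> R.
Proof.
move=> m_gt0; rewrite natr_prod; set p := \prod_v _; set s := \sum_v _.
suff [] : 0 < p /\ ln p = s by [].
rewrite /p /s; elim/big_rec2: _ => [|v y x _ [x_gt0 <-]]; first by rewrite ln1 ltr01.
have mk_gt0 : 0 < (m v)%:R ^+ k v :> R by rewrite exprn_gt0 ?ltr0n.
by rewrite natrX mulr_gt0 // lnM ?posrE // ln_exprn ?ltr0n.
Qed.

(* At [n + 1 = (M + 1)^2] the logarithm is [2 ln (M + 1) <= 2 M], against [n = M (M + 2)]. *)
Lemma le0_of_natrM_le_ln (R : realType) (c d : R) : 0 <= c ->
  (forall n, (0 < n)%N -> n%:R * d <= c * ln n.+1%:R) -> d <= 0.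
Proof.
move=> c0 d_le; rewrite leNgt; apply/negP => d_gt0.
have d_bound M : M.+3%:R * d <= 2 * c.
  have := d_le (M.+1 * M.+3)%N isT.
  have -> : (M.+1 * M.+3).+1 = (M.+2 ^ 2)%N by lia.
  rewrite natrX ln_exprn ?ltr0n // natrM -mulrA => /le_trans M_le.
  rewrite -(ler_pM2l (_ : 0 < M.+1%:R)) ?ltr0n //; apply: M_le.
  have : ln M.+2%:R <= M.+1%:R :> R.
    by rewrite -[M.+2%:R]natr1 addrC; apply: le_ln1Dx; rewrite (lt_le_trans (ltrN10 R)).
  have -> : M.+1%:R * (2 * c) = c * (2 * M.+1%:R) by ring.
  by move=> ln_le; rewrite ler_wpM2l // ler_pM2l.
have /andP[_] := truncn_itv (divr_ge0 (mulr_ge0 (ler0n R 2) c0) (ltW d_gt0)).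
set M := Num.truncn _; rewrite ltr_pdivrMr // => M_gt.
have := d_bound M; rewrite leNgt => /negP; apply; apply: lt_trans M_gt _.
by rewrite ltr_pM2r // ltr_nat.
Qed.

Lemma le_of_exprn_le_poly (R : realType) (x y : R) (c : nat) : 0 <= x -> 0 <= y ->
  (forall n, (0 < n)%N -> x ^+ n <= n.+1%:R ^+ c * y ^+ n) -> x <= y.
Proof.
rewrite le_eqVlt => /predU1P[<- //|x_gt0]; rewrite le_eqVlt => /predU1P[<-|y_gt0] xy_le.
  by have := xy_le 1%N isT; rewrite !expr1 mulr0.
rewrite -ler_ln ?posrE // -subr_le0; apply: (@le0_of_natrM_le_ln _ c%:R) => // n n_gt0.
have n1_gt0 : 0 < n.+1%:R :> R by rewrite ltr0n.
have := xy_le n n_gt0; rewrite -ler_ln ?posrE ?mulr_gt0 ?exprn_gt0 //.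
by rewrite lnM ?posrE ?exprn_gt0 // !ln_exprn // mulrBr lerBlDr.
Qed.

Section WeightedRefinement.
Variables (R : realType) (f : graph -> R) (a : R).
Hypothesis f_spectral : spectralG f.
Implicit Type W : wgraph.

Definition log_wcount_class W (k : gV W -> nat) : R :=
  ln (wvalue f a (wcount_class (\sum_v k v) k)).

(* [(\sum_v k v) * log f_alpha(S, Q)] for the type [Q] with counts [k]. *)
Definition log_wrefine W (k : gV W -> nat) : R :=
  log_refine f k + a * \sum_v (k v)%:R * ln (mult v)%:R.

Lemma prod_mult_gt0 W (k : gV W -> nat) : 0 < (\prod_v mult v ^ k v)%N%:R :> R.
Proof. by rewrite ltr0n prodn_gt0 // => v; rewrite expn_gt0 fib_gt0. Qed.

Lemma wvalue_wcount_class_gt0 W n (k : gV W -> nat) :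
  (\sum_v k v = n)%N -> 0 < wvalue f a (wcount_class n k).
Proof.
move=> sum_k; rewrite wvalue_wcount_class //.
by rewrite mulr_gt0 ?powR_gt0 ?prod_mult_gt0 ?spectral_count_class_gt0.
Qed.

Lemma log_wcount_classE W (k : gV W -> nat) :
  log_wcount_class k = log_class f k + a * \sum_v (k v)%:R * ln (mult v)%:R.
Proof.
rewrite /log_wcount_class wvalue_wcount_class //.
rewrite lnM ?posrE ?spectral_count_class_gt0 ?powR_gt0 ?prod_mult_gt0 //.
by rewrite ln_powR ln_prod_expn // => v; apply: fib_gt0.
Qed.

Lemma log_wcount_class_muln W (k : gV W -> nat) j :
  log_wcount_class (fun v => j * k v)%N =
  log_class f (fun v => j * k v)%N + j%:R * (a * \sum_v (k v)%:R * ln (mult v)%:R).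
Proof.
rewrite log_wcount_classE [in RHS]mulrCA [in RHS]mulr_sumr.
by under eq_bigr do rewrite natrM -mulrA.
Qed.

Lemma log_wcount_class_le W (k : gV W -> nat) : log_wcount_class k <= log_wrefine k.
Proof.
rewrite log_wcount_classE lerD2r.
exact: (le_growth (@log_class_linear_bound _ _ f_spectral W)).
Qed.

Lemma log_wcount_class_muln_le W (k : gV W -> nat) j :
  log_wcount_class (fun v => j.+1 * k v)%N <= j.+1%:R * log_wrefine k.
Proof.
rewrite log_wcount_class_muln mulrDr lerD2r.
exact: (le_growth_muln (@log_class_linear_bound _ _ f_spectral W)).
Qed.

Lemma log_wrefine_le W (k : gV W -> nat) x :
  (forall j, log_wcount_class (fun v => j.+1 * k v)%N <= j.+1%:R * x) -> log_wrefine k <= x.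
Proof.
move=> class_le; rewrite -lerBrDr.
apply: (growth_le (@log_class_linear_bound _ _ f_spectral W)) => j.
by rewrite mulrBr lerBrDr -log_wcount_class_muln.
Qed.

Lemma log_wrefine_le_wvalue W (k : gV W -> nat) :
  log_wrefine k <= (\sum_v k v)%:R * ln (wvalue f a W).
Proof.
apply: log_wrefine_le => j; rewrite mulrA -natrM big_distrr /=.
apply: ln_le_of_le_exprn (wvalue_wcount_class_le _ f_spectral _ _) => //.
  exact: wvalue_wcount_class_gt0.
exact: wvalue_ge0.
Qed.

Lemma wvalue_gt0 W (v : gV W) : 0 < wvalue f a W.
Proof.
have sum1 : (\sum_u (u == v) = 1)%N by rewrite (big_only1 v) ?eqxx // => u /negbTE ->.
exact: lt_le_trans (wvalue_wcount_class_gt0 sum1) (wvalue_wcount_class_le _ f_spectral 1 _).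
Qed.

(* There are at most [(n + 1) ^ |V|] types of words of length [n]. *)
Lemma wvalue_le_of_log_wrefine_le W W' (phi : gV W -> gV W') :
  (forall k, (0 < \sum_v k v)%N -> log_wrefine k <= log_wrefine (push_counts phi k)) ->
  wvalue f a W <= wvalue f a W'.
Proof.
move=> refine_le; apply: (@le_of_exprn_le_poly _ _ _ #|gV W|); rewrite ?wvalue_ge0 // => n n_gt0.
have class_le (k : gV W -> nat) : (0 < \sum_v k v)%N ->
    wvalue f a (wcount_class (\sum_v k v) k) <= wvalue f a W' ^+ (\sum_v k v).
  move=> k_gt0; have [v _] := exists_gt0_of_sum_gt0 k_gt0.
  rewrite -ler_ln ?posrE ?exprn_gt0 ?wvalue_wcount_class_gt0 ?(wvalue_gt0 (phi v)) //.
  rewrite ln_exprn ?(wvalue_gt0 (phi v)) // -[in leRHS](sum_push_counts phi).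
  apply: le_trans (log_wrefine_le_wvalue _).
  exact: le_trans (log_wcount_class_le _) (refine_le _ k_gt0).
apply: le_trans (wvalue_exprn_le a f_spectral W n) _.
apply: (@le_trans _ _ (\sum_(k : {ffun gV W -> 'I_n.+1} | (\sum_v k v == n)%N)
    wvalue f a W' ^+ n)).
  by apply: ler_sum => k /eqP sum_k; have := class_le (fun v => k v); rewrite sum_k; apply.
rewrite sumr_const -[_ *+ #|_|]mulr_natl ler_wpM2r ?exprn_ge0 ?wvalue_ge0 //.
by rewrite -natrX ler_nat; apply: leq_trans (max_card _) _; rewrite card_ffun card_ord.
Qed.

End WeightedRefinement.

Lemma log_wrefine_convex_comb (R : realType) (lambda : R) (f g h : graph -> R) (alpha beta : R) :
  spectralG f -> spectralG g -> spectralG h -> refine_convex_comb lambda f g h ->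
  forall (W : wgraph) (k : gV W -> nat), (0 < \sum_v k v)%N ->
  log_wrefine h (lambda * alpha + (1 - lambda) * beta) k =
  lambda * log_wrefine f alpha k + (1 - lambda) * log_wrefine g beta k.
Proof.
move=> f_spec g_spec h_spec refine_convex W k k_gt0; rewrite /log_wrefine.
rewrite (log_refine_convex_comb f_spec g_spec h_spec refine_convex) //.
by ring.
Qed.

(** * Operators *)

Section Operators.
Variable R : realType.
Local Notation C := R[i].

Lemma opadjK (I J : finType) (A : op R I J) : opadj (opadj A) = A.
Proof. by apply/funext => p; apply/funext => q; rewrite /opadj conjCK. Qed.

Lemma opmulA (I J K L : finType) (A : op R I J) (B : op R J K) (D : op R K L) :
  opmul A (opmul B D) = opmul (opmul A B) D.
Proof.
apply/funext => p; apply/funext => q; rewrite /opmul.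
under eq_bigr do rewrite mulr_sumr.
under [RHS]eq_bigr do rewrite mulr_suml.
rewrite exchange_big; apply: eq_bigr => r _; apply: eq_bigr => t _.
by rewrite mulrA.
Qed.

Lemma opmul1 (I J : finType) (A : op R I J) : opmul A (@opid R J) = A.
Proof.
apply/funext => p; apply/funext => q; rewrite /opmul /opid.
by rewrite (big_only1 q) // ?eqxx ?mulr1 // => r /negbTE ->; rewrite mulr0.
Qed.

Lemma op1mul (I J : finType) (A : op R I J) : opmul (@opid R I) A = A.
Proof.
apply/funext => p; apply/funext => q; rewrite /opmul /opid.
by rewrite (big_only1 p) // ?eqxx ?mul1r // => r /negbTE; rewrite eq_sym => ->; rewrite mul0r.
Qed.

Lemma nc_iso_le (S T : ncgraph R) : nc_iso S T -> nc_le S T /\ nc_le T S.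
Proof.
move=> [U [UsU [UUs UP]]].
have UsUE : opmul (opadj U) U = @opid R _ by apply/funext => p; apply/funext => q.
have UUsE : opmul U (opadj U) = @opid R _ by apply/funext => p; apply/funext => q.
split.
  exists 1%N, (fun=> U); split => [p q|_ _ X SX]; first by rewrite big_ord1.
  by apply/UP; rewrite -!opmulA UUsE opmul1 !opmulA UUsE op1mul.
exists 1%N, (fun=> opadj U); split => [p q|_ _ X SX].
  by rewrite big_ord1 opadjK.
by rewrite opadjK; apply/UP.
Qed.

Lemma exists_neq0_of_complete (n : nat) (I J : finType) (E : 'I_n -> op R I J) q :
  \sum_i opmul (opadj (E i)) (E i) q q = 1 -> exists ip, E ip.1 ip.2 q != 0.
Proof.
move=> E1; apply: contrapT => E0; have /eqP := oner_neq0 C; rewrite -E1; apply.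
apply: big1 => i _; apply: big1 => p _; have [->|Eip] := eqVneq (E i p q) 0.
  by rewrite mulr0.
by case: E0; exists (i, p).
Qed.

End Operators.

(** * Noncommutative graphs of weighted graphs *)

Section Coordinates.
Variable R : realType.
Local Notation C := R[i].

Definition simeq_supported (W : wgraph) (c : gV W -> gV W -> C) : Prop :=
  forall u v, ~~ simeq u v -> c u v = 0.

(* [N] is, up to relabelling the basis, the span of the [|u><v| (x) I] with [u ~= v]. *)
Record coordinates (N : ncgraph R) (W : wgraph) : Type := Coordinates {
  vtx : ncI N -> gV W;
  lab : ncI N -> wlabel W;
  lab_fib : forall p, lab p \in fib (vtx p);
  coord_inj : forall p q, vtx p = vtx q -> lab p = lab q -> p = q;
  coord_surj : forall v l, l \in fib v -> exists2 p, vtx p = v & lab p = l;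
  coordP : forall X, @ncS R N X <-> exists2 c, simeq_supported c &
    forall p q, X p q = c (vtx p) (vtx q) * (lab p == lab q)%:R }.

Section Theory.
Variables (N : ncgraph R) (W : wgraph) (e : coordinates N W).

Lemma coord_eqE p q : (p == q) = (vtx e p == vtx e q) && (lab e p == lab e q).
Proof. by apply/eqP/andP => [->|[/eqP vpq /eqP lpq]]; [rewrite !eqxx|exact: coord_inj vpq lpq]. Qed.

Lemma opid_coord p q : @opid R (ncI N) p q = (vtx e p == vtx e q)%:R * (lab e p == lab e q)%:R.
Proof. by rewrite /opid coord_eqE -natrM mulnb. Qed.

Lemma exists_coord_at : exists at_ : gV W -> wlabel W -> ncI N,
  (forall v l, l \in fib v -> vtx e (at_ v l) = v /\ lab e (at_ v l) = l) /\
  forall p, at_ (vtx e p) (lab e p) = p.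
Proof.
have at_ (vl : gV W * wlabel W) : exists p,
    vl.2 \in fib vl.1 -> vtx e p = vl.1 /\ lab e p = vl.2.
  case: vl => v l /=; have [/(coord_surj e)[p <- <-]|_] := boolP (l \in fib v).
    by exists p.
  have /card_gt0P[l' /(coord_surj e)[p _ _]] := fib_gt0 v.
  by exists p.
have [at' atP] := choice at_; exists (fun v l => at' (v, l)); split=> [v l|p].
  exact: (atP (v, l)).
have [vtx_at lab_at] := atP (vtx e p, lab e p) (lab_fib e p).
exact: coord_inj vtx_at lab_at.
Qed.

Lemma coord_sum (F : gV W -> wlabel W -> C) :
  \sum_p F (vtx e p) (lab e p) = \sum_v \sum_(l in fib v) F v l.
Proof.
have [at_ [atP atK]] := exists_coord_at.
rewrite pair_big_dep /= (reindex (fun p => (vtx e p, lab e p))) /=.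
  by apply/esym/eq_bigl => p; rewrite lab_fib.
exists (fun vl => at_ vl.1 vl.2) => [p _|[v l] /atP[vE lE]] /=; first exact: atK.
by rewrite vE lE.
Qed.

Definition edge_op (u v : gV W) : op R (ncI N) (ncI N) :=
  fun p q => ((vtx e p == u) && (vtx e q == v))%:R * (lab e p == lab e q)%:R.

Lemma edge_op_in u v (a : C) : simeq u v -> @ncS R N (fun p q => a * edge_op u v p q).
Proof.
move=> uv; apply/(coordP e).
exists (fun x y => a * ((x == u) && (y == v))%:R) => [x y|p q]; last by rewrite mulrA.
by case: andP => [[/eqP -> /eqP ->] /negP[]|] //; rewrite mulr0.
Qed.

Section Sandwich.
Variables (X : op R (ncI N) (ncI N)) (d : gV W -> gV W -> C).
Hypothesis d_supp : simeq_supported d.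
Hypothesis XE : forall p q, X p q = d (vtx e p) (vtx e q) * (lab e p == lab e q)%:R.

Lemma opmul_coord (K : finType) (F : op R (ncI N) K) (F0 : gV W -> wlabel W -> C) q :
  (forall p, F p q = F0 (vtx e p) (lab e p)) ->
  forall p, opmul X F p q = \sum_v d (vtx e p) v * F0 v (lab e p).
Proof.
move=> FE p; rewrite /opmul.
under eq_bigr do rewrite XE FE.
rewrite (coord_sum (fun v l => d (vtx e p) v * (lab e p == l)%:R * F0 v l)).
apply: eq_bigr => v _; have [pv|/d_supp ->] := boolP (simeq (vtx e p) v); last first.
  by rewrite mul0r big1 // => l _; rewrite !mul0r.
rewrite (big_only1 (lab e p)) ?eqxx ?mulr1 //; first by rewrite -(fib_simeq pv) lab_fib.
by move=> l /negbTE; rewrite eq_sym => -> _; rewrite mulr0 mul0r.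
Qed.

Lemma sandwich_coord (J K : finType) (E : op R (ncI N) J) (F : op R (ncI N) K)
    (E0 F0 : gV W -> wlabel W -> C) q q' :
  (forall p, E p q = E0 (vtx e p) (lab e p)) -> (forall p, F p q' = F0 (vtx e p) (lab e p)) ->
  opmul (opadj E) (opmul X F) q q' =
  \sum_v \sum_v' d v v' * \sum_(l in fib v) (E0 v l)^* * F0 v' l.
Proof.
move=> EE FE; rewrite {1}/opmul /opadj.
under eq_bigr do rewrite EE (opmul_coord FE).
rewrite (coord_sum (fun v l => (E0 v l)^* * \sum_v' d v v' * F0 v' l)).
apply: eq_bigr => v _; under eq_bigr do rewrite mulr_sumr.
rewrite exchange_big; apply: eq_bigr => v' _; rewrite mulr_sumr.
by apply: eq_bigr => l _; rewrite mulrCA.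
Qed.

End Sandwich.

End Theory.

Lemma coordinates_oplus (N N' : ncgraph R) (W W' : wgraph) :
  coordinates N W -> coordinates N' W' -> coordinates (nc_oplus N N') (wdunion W W').
Proof.
move=> e e'.
pose vtx2 (p : ncI N + ncI N') : gV (wdunion W W') :=
  match p with inl p => inl (vtx e p) | inr p => inr (vtx e' p) end.
pose lab2 (p : ncI N + ncI N') : wlabel (wdunion W W') :=
  match p with inl p => inl (lab e p) | inr p => inr (lab e' p) end.
exists vtx2 lab2.
- by case=> p; apply: imset_f; apply: lab_fib.
- by case=> p [] q //= [vpq] [lpq]; rewrite (coord_inj vpq lpq).
- case=> v l /imsetP[l' l'v ->].
    by have [p <- <-] := coord_surj e l'v; exists (inl p).
  by have [p <- <-] := coord_surj e' l'v; exists (inr p).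
move=> X; split.
  case=> /(coordP e)[c c_supp XE] /(coordP e')[c' c'_supp XE'] X12 X21.
  exists (fun u v : gV W + gV W' => match u, v with
    | inl a, inl b => c a b | inr a, inr b => c' a b | _, _ => 0 end).
    by case=> u [] v // uv; [apply: c_supp|apply: c'_supp].
  by case=> p [] q /=; rewrite ?X12 ?X21 ?mul0r // ?XE ?XE'.
case=> c c_supp XE; split.
- apply/(coordP e); exists (fun u v => c (inl u) (inl v)) => [u v uv|p q]; last exact: XE.
  exact: c_supp.
- apply/(coordP e'); exists (fun u v => c (inr u) (inr v)) => [u v uv|p q]; last exact: XE.
  exact: c_supp.
- by move=> p q; rewrite XE c_supp ?mul0r.
- by move=> p q; rewrite XE c_supp ?mul0r.
Qed.

Section Tensor.
Variables (N N' : ncgraph R) (W W' : wgraph) (e : coordinates N W) (e' : coordinates N' W').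
Let vtx2 (p : ncI N * ncI N') : gV (wsprod W W') := (vtx e p.1, vtx e' p.2).
Let lab2 (p : ncI N * ncI N') : wlabel (wsprod W W') := (lab e p.1, lab e' p.2).

Let lab2_eqE p q : (lab2 p == lab2 q)%:R =
  (lab e p.1 == lab e q.1)%:R * (lab e' p.2 == lab e' q.2)%:R :> C.
Proof. by rewrite xpair_eqE -natrM mulnb. Qed.

Lemma coord_of_otimes X : @ncS R (nc_otimes N N') X -> exists2 c, simeq_supported c &
  forall p q, X p q = c (vtx2 p) (vtx2 q) * (lab2 p == lab2 q)%:R.
Proof.
case=> n [A [B [AB XE]]].
have A_coord k : exists c, simeq_supported c /\
    forall p q, A k p q = c (vtx e p) (vtx e q) * (lab e p == lab e q)%:R.
  by have [/(coordP e)[c c_supp AE] _] := AB k; exists c.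
have B_coord k : exists c, simeq_supported c /\
    forall p q, B k p q = c (vtx e' p) (vtx e' q) * (lab e' p == lab e' q)%:R.
  by have [_ /(coordP e')[c c_supp BE]] := AB k; exists c.
have [c cP] := choice A_coord; have [c' c'P] := choice B_coord.
exists (fun u v => \sum_k c k u.1 v.1 * c' k u.2 v.2) => [u v|p q].
  rewrite simeq_sprod negb_and => /orP[uv|uv]; rewrite big1 // => k _.
    by rewrite (proj1 (cP k)) ?mul0r.
  by rewrite (proj1 (c'P k)) ?mulr0.
rewrite XE mulr_suml; apply: eq_bigr => k _.
by rewrite (proj2 (cP k)) (proj2 (c'P k)) lab2_eqE mulrACA.
Qed.

Lemma otimes_of_coord X c : simeq_supported c ->
  (forall p q, X p q = c (vtx2 p) (vtx2 q) * (lab2 p == lab2 q)%:R) ->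
  @ncS R (nc_otimes N N') X.
Proof.
move=> c_supp XE; pose T : finType := ((gV W * gV W) * (gV W' * gV W'))%type.
pose A : {pred T} := fun t => simeq t.1.1 t.1.2 && simeq t.2.1 t.2.2.
exists #|A|.
exists (fun k p q => let t := enum_val k in
  c (t.1.1, t.2.1) (t.1.2, t.2.2) * edge_op e t.1.1 t.1.2 p q).
exists (fun k p q => let t := enum_val k in 1 * edge_op e' t.2.1 t.2.2 p q).
split=> [k|p q]; first by have /andP[s1 s2] := enum_valP k; split; apply: edge_op_in.
pose t0 : T := ((vtx e p.1, vtx e q.1), (vtx e' p.2, vtx e' q.2)).
rewrite -(big_enum_val (A := A) (fun t : T =>
  c (t.1.1, t.2.1) (t.1.2, t.2.2) * edge_op e t.1.1 t.1.2 p.1 q.1 *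
  (1 * edge_op e' t.2.1 t.2.2 p.2 q.2))) big_mkcond (big_only1 t0) //= => [|t t_neq _].
  rewrite /edge_op !eqxx !mul1r -mulrA -lab2_eqE -XE; case: ifPn => // nA.
  by rewrite XE c_supp ?mul0r // simeq_sprod.
case: ifP => // _; rewrite /edge_op.
case: andP => [[/eqP p1 /eqP q1]|]; last by rewrite mul0r mulr0 mul0r.
case: andP => [[/eqP p2 /eqP q2]|]; last by rewrite mul0r !mulr0.
by case/eqP: t_neq; rewrite /t0 p1 q1 p2 q2; case: t {p1 q1 p2 q2} => [[? ?] [? ?]].
Qed.

Lemma coordinates_otimes : coordinates (nc_otimes N N') (wsprod W W').
Proof.
exists vtx2 lab2.
- by move=> p; rewrite inE /= !lab_fib.
- move=> [p p'] [q q'] [vpq vpq'] [lpq lpq'].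
  by rewrite (coord_inj vpq lpq) (coord_inj vpq' lpq').
- move=> [v v'] [l l']; rewrite inE /= => /andP[/(coord_surj e)[p pv pl]].
  by move=> /(coord_surj e')[p' p'v p'l]; exists (p, p'); rewrite /vtx2 /lab2 /= ?pv ?p'v ?pl ?p'l.
- by move=> X; split=> [|[c]]; [exact: coord_of_otimes|exact: otimes_of_coord].
Qed.

End Tensor.

End Coordinates.

(** * Cohomomorphisms between weighted graphs *)

Section BlockCohomomorphisms.
Variable R : realType.
Local Notation C := R[i].
Implicit Type W : wgraph.

(* [A x] is the matrix of an isometry from [C^(fib x)] to [C^(fib (phi x))]; the blocks of two
   vertices with indistinguishable images overlap in the scalar [c x y]. *)
Record block_cohom W W' (phi : gV W -> gV W') (A : gV W -> wlabel W' -> wlabel W -> C)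
    (c : gV W -> gV W -> C) : Prop := BlockCohom {
  block_overlap : forall x y, simeq (phi x) (phi y) ->
    forall b b', b \in fib x -> b' \in fib y ->
    \sum_(l in fib (phi x)) (A x l b)^* * A y l b' = c x y * (b == b')%:R;
  block_supp : simeq_supported c;
  block_norm : forall x, c x x = 1 }.

Section OfLe.
Variables (N N' : ncgraph R) (W W' : wgraph) (e : coordinates N W) (e' : coordinates N' W').

Lemma sandwich_edge_op (I J : finType) (E : op R (ncI N') I) (F : op R (ncI N') J)
    (at_ : gV W' -> wlabel W' -> ncI N') u v q q' :
  (forall p, at_ (vtx e' p) (lab e' p) = p) -> simeq u v ->
  opmul (opadj E) (opmul (edge_op e' u v) F) q q' =
  \sum_(l in fib u) (E (at_ u l) q)^* * F (at_ v l) q'.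
Proof.
move=> atK uv; pose d x y : C := ((x == u) && (y == v))%:R.
have d_supp : simeq_supported d.
  by move=> x y; rewrite /d; case: andP => [[/eqP -> /eqP ->] /negP[]|].
rewrite (sandwich_coord (e := e') (d := d) d_supp _ (E0 := fun w l => E (at_ w l) q)
  (F0 := fun w l => F (at_ w l) q')) // => [|p|p]; rewrite ?atK //.
rewrite (big_only1 u) // => [|w /negbTE wu _]; last first.
  by apply: big1 => w' _; rewrite /d wu mul0r.
by rewrite (big_only1 v) /d ?eqxx ?mul1r // => w /negbTE wv _; rewrite wv andbF mul0r.
Qed.

Lemma exists_overlap (E F : op R (ncI N') (ncI N)) (at_ : gV W -> wlabel W -> ncI N)
    (at' : gV W' -> wlabel W' -> ncI N') :
  (forall v l, l \in fib v -> vtx e (at_ v l) = v /\ lab e (at_ v l) = l) ->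
  (forall p, at' (vtx e' p) (lab e' p) = p) ->
  (forall X, @ncS R N' X -> @ncS R N (opmul (opadj E) (opmul X F))) ->
  forall x y u v, exists c : C, (~~ simeq x y -> c = 0) /\
    (simeq u v -> forall b b', b \in fib x -> b' \in fib y ->
      \sum_(l in fib u) (E (at' u l) (at_ x b))^* * F (at' v l) (at_ y b') = c * (b == b')%:R).
Proof.
move=> atP at'K EF x y u v.
have [uv|] := boolP (simeq u v); last by exists 0; split.
have /EF/(coordP e)[d d_supp dE] := @edge_op_in _ _ _ e' u v 1 uv.
exists (d x y); split=> [|_ b b' bx by']; first exact: d_supp.
have [vb lb] := atP _ _ bx; have [vb' lb'] := atP _ _ by'.
rewrite -(sandwich_edge_op _ _ _ _ at'K uv).
have := dE (at_ x b) (at_ y b'); rewrite vb vb' lb lb' => <-.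
by congr (opmul (opadj E) (opmul _ F) _ _); apply/funext => p; apply/funext => q; rewrite mul1r.
Qed.

Lemma block_cohom_of_nc_le : nc_le N N' -> exists phi A c, @block_cohom W W' phi A c.
Proof.
move=> [n [E [E1 ES]]].
have [at_ [atP atK]] := exists_coord_at e; have [at' [at'P at'K]] := exists_coord_at e'.
have nonzero x : exists ipq, vtx e ipq.2 = x /\ E ipq.1.1 ipq.1.2 ipq.2 != 0.
  have /card_gt0P[l /(coord_surj e)[q qx _]] := fib_gt0 x.
  have [|ip Eip] := @exists_neq0_of_complete _ _ _ _ E q; first by rewrite E1 /opid eqxx.
  by exists (ip, q).
have {nonzero}[ipq ipqP] := choice nonzero.
pose phi x := vtx e' (ipq x).1.2.
pose A x l b : C := E (ipq x).1.1 (at' (phi x) l) (at_ x b).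
have overlap (xy : gV W * gV W) := exists_overlap atP at'K
  (ES (ipq xy.1).1.1 (ipq xy.2).1.1) xy.1 xy.2 (phi xy.1) (phi xy.2).
have {overlap}[c cP] := choice overlap.
have c_gt0 x : 0 < c (x, x).
  have [qx Eq] := ipqP x; have bx := lab_fib e (ipq x).2; rewrite qx in bx.
  have [_ /(_ (simeqxx _) _ _ bx bx)] := cP (x, x); rewrite eqxx mulr1 => <- /=.
  rewrite (bigD1 (lab e' (ipq x).1.2)) ?lab_fib //= ltr_pwDl //.
    by rewrite mulrC -normCK exprn_gt0 // normr_gt0 at'K -{3}qx atK.
  by apply: sumr_ge0 => l _; rewrite mulrC -normCK exprn_ge0.
pose s x := sqrtC (c (x, x)).
have s_conj x : (s x)^* = s x by apply: conj_Creal; rewrite gtr0_real // sqrtC_gt0.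
exists phi, (fun x l b => A x l b / s x), (fun x y => c (x, y) / (s x * s y)); split.
- move=> x y xy b b' bx by'; have [_ cE] := cP (x, y).
  rewrite mulrAC -(cE xy b b' bx by') mulr_suml; apply: eq_bigr => l _.
  by rewrite rmorphM /= fmorphV /= s_conj invfM mulrACA.
- by move=> x y xy; have [c0 _] := cP (x, y); rewrite c0 ?mul0r.
- by move=> x; rewrite -expr2 sqrtCK divff // gt_eqF.
Qed.

End OfLe.

Section ToLe.
Variables (N N' : ncgraph R) (W W' : wgraph) (e : coordinates N W) (e' : coordinates N' W').
Variables (phi : gV W -> gV W') (A : gV W -> wlabel W' -> wlabel W -> C) (c : gV W -> gV W -> C).
Hypothesis cohomA : block_cohom phi A c.

Definition block_op (x : gV W) : op R (ncI N') (ncI N) :=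
  fun p q => (vtx e' p == phi x)%:R * ((vtx e q == x)%:R * A x (lab e' p) (lab e q)).

Lemma sandwich_block_op X d : simeq_supported d ->
  (forall p q, X p q = d (vtx e' p) (vtx e' q) * (lab e' p == lab e' q)%:R) ->
  forall x y q q', opmul (opadj (block_op x)) (opmul X (block_op y)) q q' =
    ((vtx e q == x) && (vtx e q' == y))%:R * (d (phi x) (phi y) * c x y)
    * (lab e q == lab e q')%:R.
Proof.
move=> d_supp XE x y q q'.
rewrite (sandwich_coord d_supp XE
  (E0 := fun v l => (v == phi x)%:R * ((vtx e q == x)%:R * A x l (lab e q)))
  (F0 := fun v l => (v == phi y)%:R * ((vtx e q' == y)%:R * A y l (lab e q')))) //.
rewrite (big_only1 (phi x)) // => [|v /negbTE vx _]; last first.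
  by apply: big1 => w _; rewrite big1 ?mulr0 // => l _; rewrite vx mul0r conjC0 mul0r.
rewrite (big_only1 (phi y)) // => [|w /negbTE wy _]; last first.
  by rewrite big1 ?mulr0 // => l _; rewrite wy mul0r mulr0.
have [xy|/d_supp ->] := boolP (simeq (phi x) (phi y)); last by rewrite !mul0r mulr0 mul0r.
rewrite !eqxx; under eq_bigr do rewrite !mul1r rmorphM /= conjC_nat.
have [/eqP qx|_] := boolP (vtx e q == x); last first.
  by rewrite big1 ?mulr0 ?mul0r // => l _; rewrite !mul0r.
have [/eqP q'y|_] := boolP (vtx e q' == y); last first.
  by rewrite big1 ?mulr0 ?mul0r // => l _; rewrite mul0r mulr0.
under eq_bigr do rewrite !mul1r.
by rewrite (block_overlap cohomA xy) ?mul1r ?mulrA // -?qx -?q'y lab_fib.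
Qed.

Lemma nc_le_of_block_cohom : nc_le N N'.
Proof.
exists #|gV W|, (fun i => block_op (enum_val i)); split=> [q q'|i j X /(coordP e')[d d_supp XE]].
  rewrite -(big_enum_val (A := gV W) (fun x => opmul (opadj (block_op x)) (block_op x) q q')) /=.
  pose d (u v : gV W') : C := (u == v)%:R.
  have d_supp : simeq_supported d by move=> u v; rewrite /d; case: eqP => // ->; rewrite simeqxx.
  have sandwich x := sandwich_block_op d_supp (opid_coord e') x x q q'.
  under eq_bigr => x _ do rewrite -[block_op x in X in opmul _ X]op1mul sandwich.
  rewrite (big_only1 (vtx e q)) // => [|x /negbTE xq _]; last by rewrite eq_sym xq !mul0r.
  rewrite /d (block_norm cohomA) !eqxx !mulr1 [_ == vtx e q]eq_sym.
  by rewrite -opid_coord.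
apply/(coordP e); set x := enum_val i; set y := enum_val j.
exists (fun u v => ((u == x) && (v == y))%:R * (d (phi x) (phi y) * c x y)) => [u v uv|q q'].
  case: andP => [[/eqP ux /eqP vy]|]; last by rewrite mul0r.
  by rewrite (block_supp cohomA) ?mulr0 // -ux -vy.
exact: sandwich_block_op.
Qed.

End ToLe.

Section Powers.
Variables (W W' : wgraph) (phi : gV W -> gV W').
Variables (A : gV W -> wlabel W' -> wlabel W -> C) (c : gV W -> gV W -> C).
Hypothesis cohomA : block_cohom phi A c.
Variables (n : nat) (k : gV W -> nat).

Let letter (x : gV (wcount_class n k)) (i : 'I_n) : gV W := (val x : {ffun 'I_n -> gV W}) i.

Lemma has_counts_map (x : gV (wcount_class n k)) :
  @has_counts W' n (push_counts phi k) ([ffun i => phi (letter x i)] : {ffun 'I_n -> gV W'}).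
Proof.
apply/forallP => w; rewrite occurrences_map; apply/eqP; apply: eq_bigr => v _.
by have /forallP/(_ v)/eqP := valP x.
Qed.

Definition map_count_class (x : gV (wcount_class n k)) :
    gV (@wcount_class W' n (push_counts phi k)) :=
  exist (@has_counts W' n (push_counts phi k)) _ (has_counts_map x).

Lemma block_cohom_count_class :
  @block_cohom (wcount_class n k) (wcount_class n (push_counts phi k)) map_count_class
    (fun x l b => \prod_i A (letter x i) ((l : {ffun _ -> _}) i) ((b : {ffun _ -> _}) i))
    (fun x y => \prod_i c (letter x i) (letter y i)).
Proof.
split=> [x y|x y|x].
- rewrite simeq_induced simeq_gpow => /forallP xy b b'; rewrite !inE => /familyP bx /familyP by'.
  have {}xy i : simeq (phi (letter x i)) (phi (letter y i)) by have := xy i; rewrite !ffunE.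
  under [LHS]eq_bigr do rewrite rmorph_prod -big_split /=.
  rewrite (eq_bigl (mem (family (fun i => fib (phi (letter x i)))))) => [|l]; last first.
    by rewrite inE; apply: eq_forallb => i; rewrite /= ffunE.
  rewrite -(bigA_distr_big_dep (fun i => mem (fib (phi (letter x i)))) (fun i l =>
    (A (letter x i) l ((b : {ffun _ -> _}) i))^* * A (letter y i) l ((b' : {ffun _ -> _}) i))).
  under eq_bigr => i _ do rewrite (block_overlap cohomA (xy i) (bx i) (by' i)).
  rewrite big_split /=; congr (_ * _); have [->|bb'] := eqVneq b b'.
    by rewrite big1 // => i _; rewrite eqxx.
  apply/eqP; apply: contraNT bb' => /prodf_neq0 eq_b; apply/eqP/ffunP => i.
  by have := eq_b i isT; rewrite pnatr_eq0 eqb0 negbK => /eqP.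
- rewrite simeq_induced simeq_gpow => /forallPn[i /(block_supp cohomA) ci].
  by rewrite (bigD1 i) //= ci mul0r.
- by rewrite big1 // => i _; apply: (block_norm cohomA).
Qed.

End Powers.

End BlockCohomomorphisms.

(** * Elements of the semiring as weighted graphs *)

Section Areps.
Variable R : realType.
Local Notation C := R[i].
Implicit Types (s : Arep) (W : wgraph).

Definition Avertex s : finType := {d : 'I_(size s) & gV (Ablock d)}.

Definition Amk s (d : 'I_(size s)) (x : gV (Ablock d)) : Avertex s :=
  Tagged (fun d => gV (Ablock d)) x.

Definition Asimeq s : rel (Avertex s) :=
  fun u v => (tag u == tag v) && simeq (tagged u) (tagged_as u v).

Lemma AsimeqT s (d : 'I_(size s)) (x y : gV (Ablock d)) :
  Asimeq (Amk x) (Amk y) = simeq x y.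
Proof. by rewrite /Asimeq /= eqxx /= tagged_asE. Qed.

Lemma Asimeq_refl s : reflexive (@Asimeq s).
Proof. by move=> [d x]; rewrite AsimeqT simeqxx. Qed.

Lemma Asimeq_sym s : symmetric (@Asimeq s).
Proof.
move=> [d x] [d' y]; have [dd'|dd'] := eqVneq d d'.
  by subst d'; rewrite !AsimeqT simeq_sym.
by rewrite /Asimeq /= (negbTE dd') eq_sym (negbTE dd').
Qed.

Definition Avtx s (p : Aidx s) : Avertex s := Amk (tagged p).1.

Definition Asrc s (g : Agen s) : Avertex s := Amk (tagged g).1.

Definition Atgt s (g : Agen s) : Avertex s := Amk (tagged g).2.

Lemma AgenopE s (g : Agen s) (p q : Aidx s) :
  Agenop R g p q = [&& Avtx p == Asrc g, Avtx q == Atgt g & (tagged p).2 == (tagged q).2 :> nat]%:R.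
Proof.
rewrite /Agenop; congr (nat_of_bool _)%:R; case: g => d [x y].
apply/existsP/and3P => [[i /andP[/eqP -> /eqP ->]]|]; first by split => /=.
case: p q => [dp [u i]] [dq [v j]] [] /=.
move=> /eqP/[dup] /(congr1 tag) /= dpE; subst dp => /eqP.
rewrite eq_Tagged /= => /eqP ->.
move=> /eqP/[dup] /(congr1 tag) /= dqE; subst dq => /eqP.
rewrite eq_Tagged /= => /eqP -> /eqP ij.
by exists i; have -> : j = i by [apply: val_inj]; rewrite !eqxx.
Qed.

Lemma sum_Agen s (F : Avertex s -> Avertex s -> C) u v :
  (forall u v, ~~ Asimeq u v -> F u v = 0) ->
  \sum_g F (Asrc g) (Atgt g) * ((u == Asrc g) && (v == Atgt g))%:R = F u v.
Proof.
move=> F_supp; have [uv|uv] := eqVneq (tag u) (tag v); last first.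
  rewrite F_supp ?negb_and ?uv // big1 // => g _.
  case: andP => [[/eqP us /eqP vt]|_]; last by rewrite mulr0.
  by rewrite us vt eqxx in uv.
case: u v uv => d x [d' y] /= dd'; subst d'.
pose g0 : Agen s := Tagged (fun d : 'I_(size s) => (gV (Ablock d) * gV (Ablock d))%type) (x, y).
rewrite (big_only1 g0) ?eqxx ?mulr1 // => -[d' [x' y']] g_neq _.
apply: contraNeq g_neq; case: andP => [[/eqP us /eqP vt] _|]; last by rewrite mulr0 eqxx.
move: (congr1 tag us) => /= dd'; subst d'.
by move: us vt => /eqP; rewrite eq_Tagged /= => /eqP <- /eqP; rewrite eq_Tagged /= => /eqP <-.
Qed.

Lemma ArealP s X : @ncS R (Areal R s) X <->
  exists2 c : Avertex s -> Avertex s -> C, (forall u v, ~~ Asimeq u v -> c u v = 0) &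
    forall p q, X p q = c (Avtx p) (Avtx q) * ((tagged p).2 == (tagged q).2 :> nat)%:R.
Proof.
split=> [[c [c_supp XE]]|[c c_supp XE]].
  exists (fun u v => \sum_g c g * ((u == Asrc g) && (v == Atgt g))%:R) => [u v uv|p q].
    apply: big1 => g _; case: andP => [[/eqP us /eqP vt]|]; last by rewrite mulr0.
    rewrite c_supp ?mul0r //; move: uv; rewrite us vt.
    by case: (g) => d [x y]; rewrite AsimeqT.
  rewrite XE mulr_suml; apply: eq_bigr => g _.
  by rewrite AgenopE -mulrA -natrM mulnb andbA.
exists (fun g => c (Asrc g) (Atgt g)); split=> [[d [x y]] xy|p q].
  by apply: c_supp; rewrite AsimeqT.
rewrite XE -(sum_Agen _ _ c_supp) mulr_suml; apply: eq_bigr => g _.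
by rewrite AgenopE -mulrA -natrM mulnb andbA.
Qed.

Record represents s W (psi : Avertex s -> gV W) : Prop := Represents {
  rep_bij : bijective psi;
  rep_simeq : forall u v, simeq (psi u) (psi v) = Asimeq u v;
  rep_mult : forall u, mult (psi u) = (tag u).+1 }.

Lemma eq_enum_val (T : finType) (A B : {set T}) (i : 'I_#|A|) (j : 'I_#|B|) : A = B ->
  (enum_val i == enum_val j) = (i == j :> nat).
Proof. by move=> AB; subst B; rewrite (inj_eq enum_val_inj). Qed.

Lemma coordinates_of_represents s W psi : @represents s W psi -> coordinates (Areal R s) W.
Proof.
move=> psiP; have psi_inj := bij_inj (rep_bij psiP).
pose lab_ (p : Aidx s) : wlabel W :=
  enum_val (cast_ord (esym (rep_mult psiP (Avtx p))) (tagged p).2).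
have lab_eqE (p q : Aidx s) : simeq (psi (Avtx p)) (psi (Avtx q)) ->
    (lab_ p == lab_ q) = ((tagged p).2 == (tagged q).2 :> nat).
  by move=> /fib_simeq; apply: eq_enum_val.
exists (fun p => psi (Avtx p)) lab_.
- by move=> p; apply: enum_valP.
- move=> p q /psi_inj vpq lpq.
  have /eqP : (tagged p).2 == (tagged q).2 :> nat by rewrite -lab_eqE ?lpq // vpq simeqxx.
  case: p q vpq {lpq} => [d [x i]] [d' [y j]] /[dup] /(congr1 tag) /= dd'; subst d'.
  by move=> /eqP; rewrite eq_Tagged /= => /eqP -> /val_inj ->.
- move=> v l lv; have [phi _ phiK] := rep_bij psiP.
  rewrite -(phiK v) in lv *; case: (phi v) lv => d x lv.
  pose i := cast_ord (rep_mult psiP (Amk x)) (enum_rank_in lv l).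
  exists (Tagged (fun d : 'I_(size s) => (gV (Ablock d) * 'I_d.+1)%type) (x, i)) => //.
  by rewrite /lab_ /= cast_ordK enum_rankK_in.
have [phi psiK phiK] := rep_bij psiP.
move=> X; rewrite ArealP; split=> -[c c_supp XE].
  exists (fun u v => c (phi u) (phi v)) => [u v uv|p q].
    by apply: c_supp; rewrite -(rep_simeq psiP) !phiK.
  rewrite XE !psiK; have [pq|/c_supp ->] := boolP (Asimeq (Avtx p) (Avtx q)).
    by rewrite lab_eqE // (rep_simeq psiP).
  by rewrite !mul0r.
exists (fun u v => c (psi u) (psi v)) => [u v uv|p q].
  by apply: c_supp; rewrite (rep_simeq psiP).
rewrite XE; have [pq|/c_supp ->] := boolP (simeq (psi (Avtx p)) (psi (Avtx q))).
  by rewrite lab_eqE.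
by rewrite !mul0r.
Qed.

Lemma f_alpha_represents (f : graph -> R) a s W psi : spectralG f ->
  @represents s W psi -> f_alpha f a s = wvalue f a W.
Proof.
move=> f_spectral psiP; have [phi psiK phiK] := rep_bij psiP.
pose block (v : gV W) := tag (phi v).
rewrite (@wvalue_classes _ _ a f_spectral W _ block (fun d => d.+1)) => [|v|u v uv].
- apply: eq_bigr => d _; congr (_ * _); rewrite -(spectral_inducedT f_spectral (P := xpredT)) //.
  apply: (spectral_induced_eq f_spectral (phi := fun x => psi (Amk x))) => [x|v /eqP vd|x y].
  + by rewrite /block psiK eqxx.
  + by move: vd (phiK v); rewrite /block; case: (phi v) => d' x /= dd' <-; subst d'; exists x.
  + by rewrite (rep_simeq psiP) AsimeqT.
- by rewrite -(rep_mult psiP) phiK.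
- apply/eqP; move: uv; rewrite /block -{1}(phiK u) -{1}(phiK v) (rep_simeq psiP).
  by case/andP.
Qed.

Definition wgraph_of_fib s (v : gV (graph_of_rel (@Asimeq_sym s))) : {set 'I_(size s)} :=
  [set i : 'I_(size s) | (i <= tag (v : Avertex s))%N].

Lemma card_wgraph_of_fib s v : #|@wgraph_of_fib s v| = (tag (v : Avertex s)).+1.
Proof.
rewrite -sum1_card; under eq_bigl do rewrite inE -ltnS.
by rewrite (big_ord_narrow (ltn_ord (tag (v : Avertex s)))) sum1_card card_ord.
Qed.

Lemma wgraph_of_fib_gt0 s v : (0 < #|@wgraph_of_fib s v|)%N.
Proof. by rewrite card_wgraph_of_fib. Qed.

Lemma wgraph_of_fib_simeq s u v : simeq u v -> @wgraph_of_fib s u = wgraph_of_fib v.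
Proof.
rewrite simeq_graph_of_rel => [/andP[/eqP uv _]|]; last exact: Asimeq_refl.
by rewrite /wgraph_of_fib uv.
Qed.

Definition wgraph_of s : wgraph := WGraph (@wgraph_of_fib_gt0 s) (@wgraph_of_fib_simeq s).

Lemma represents_wgraph_of s : @represents s (wgraph_of s) id.
Proof.
split=> [|u v|u]; first by exists id.
- exact/simeq_graph_of_rel/Asimeq_refl.
- exact: card_wgraph_of_fib.
Qed.

Definition Arep_of W : Arep :=
  mkseq (fun d => induced (fun v : gV W => mult v == d.+1)) (\max_(v : gV W) mult v).

Lemma Ablock_Arep_of W (d : 'I_(size (Arep_of W))) : exists psi : gV (Ablock d) -> gV W,
  [/\ forall x, mult (psi x) = d.+1, forall v, mult v = d.+1 -> exists x, psi x = v, injective psi &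
      {mono psi : x y / simeq x y}].
Proof.
have lt_d : (d < \max_(v : gV W) mult v)%N.
  by apply: leq_trans (ltn_ord d) _; rewrite size_mkseq.
rewrite /Ablock nth_mkseq //.
exists val; split=> [x|v vd||x y].
- by apply/eqP; apply: valP x.
- by exists (exist _ v (introT eqP vd)).
- exact: val_inj.
- by rewrite simeq_induced.
Qed.

Lemma exists_represents W : exists psi, @represents (Arep_of W) W psi.
Proof.
pose psi_ d := projT1 (cid (@Ablock_Arep_of W d)).
pose psi (u : Avertex (Arep_of W)) : gV W := psi_ _ (tagged u).
have psiP d := projT2 (cid (@Ablock_Arep_of W d)).
have mult_psi u : mult (psi u) = (tag u).+1.
  by case: u => d x; have [-> _ _ _] := psiP d.
exists psi; split=> // [|u v].
  have psi_inj : injective psi.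
    move=> [d x] [d' y] xy; have := congr1 (@mult W) xy; rewrite !mult_psi /= => -[/val_inj dd'].
    by subst d'; have [_ _ psi_inj _] := psiP d; rewrite (psi_inj x y xy).
  have psi_surj v : exists u, psi u = v.
    have mult_gt0 : (0 < mult v)%N := fib_gt0 v.
    have lt_d : ((mult v).-1 < size (Arep_of W))%N.
      by rewrite size_mkseq prednK // leq_bigmax.
    have [_ psi_surj _ _] := psiP (Ordinal lt_d).
    by have [|x <-] := psi_surj v; [rewrite prednK|exists (Amk x)].
  have [phi phiK] := choice psi_surj.
  by exists phi => // u; apply: psi_inj; rewrite phiK.
have [uv|uv] := eqVneq (tag u) (tag v); last first.
  rewrite /Asimeq (negbTE uv); apply/negbTE; apply: contra uv => /fib_simeq uv.
  by apply/eqP/val_inj/eqP; rewrite -eqSS -!mult_psi /mult uv.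
case: u v uv => d x [d' y] /= dd'; subst d'; rewrite AsimeqT.
by have [_ _ _ psi_mono] := psiP d; apply: psi_mono.
Qed.

End Areps.

(** * Monotonicity through weighted graphs *)

Section Monotonicity.
Variables (R : realType) (f : graph -> R) (a : R).
Hypothesis f_spectral : spectralG f.

Lemma spectralA_f_alphaP : spectralA (f_alpha f a) <->
  forall (W W' : wgraph) phi A c, @block_cohom R W W' phi A c -> wvalue f a W <= wvalue f a W'.
Proof.
split=> [[_ [_ _ _ _ f_mono]] W W' phi A c cohomA|wvalue_mono].
  have [[psi psiP] [psi' psi'P]] := (exists_represents W, exists_represents W').
  rewrite -(f_alpha_represents _ f_spectral psiP) -(f_alpha_represents _ f_spectral psi'P).
  apply: f_mono; apply: nc_le_of_block_cohom cohomA.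
    exact: coordinates_of_represents psiP.
  exact: coordinates_of_represents psi'P.
pose f_alphaE s := f_alpha_represents a f_spectral (represents_wgraph_of s).
have e s := coordinates_of_represents R (represents_wgraph_of s).
have mono (N N' : ncgraph R) W W' : coordinates N W -> coordinates N' W' -> nc_le N N' ->
    wvalue f a W <= wvalue f a W'.
  move=> eN eN' /(block_cohom_of_nc_le eN eN')[phi [A [c cohomA]]].
  exact: wvalue_mono cohomA.
have mono_iso (N N' : ncgraph R) W W' : coordinates N W -> coordinates N' W' -> nc_iso N N' ->
    wvalue f a W = wvalue f a W'.
  move=> eN eN' /nc_iso_le[le le']; apply/eqP.
  by rewrite eq_le (mono _ _ _ _ eN eN' le) (mono _ _ _ _ eN' eN le').
split; first by move=> s; rewrite f_alphaE wvalue_ge0.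
split=> [||s t u iso|s t u iso|s t le].
- by rewrite /f_alpha big_ord0.
- by rewrite /f_alpha big_ord1 powR1 mulr1 spectral_card1 // card_unit.
- by rewrite !f_alphaE -wvalue_dunion //; apply: mono_iso iso => //; apply: coordinates_oplus.
- by rewrite !f_alphaE -wvalue_sprod //; apply: mono_iso iso => //; apply: coordinates_otimes.
- by rewrite !f_alphaE; apply: mono le.
Qed.

Lemma log_wrefine_le_of_block_cohom (W W' : wgraph) phi A c k : spectralA (f_alpha f a) ->
  @block_cohom R W W' phi A c -> log_wrefine f a k <= log_wrefine f a (push_counts phi k).
Proof.
move=> /spectralA_f_alphaP wvalue_mono cohomA; apply: log_wrefine_le => // j.
apply: le_trans (log_wcount_class_muln_le a f_spectral (push_counts phi k) j).
rewrite -push_countsM /log_wcount_class ler_ln ?posrE ?wvalue_wcount_class_gt0 //.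
rewrite sum_push_counts; exact: wvalue_mono (block_cohom_count_class cohomA _ _).
Qed.

End Monotonicity.

Theorem theorem4p2 (R : realType) (f g h : graph -> R) (alpha beta lambda : R) :
  spectralG f -> spectralG g -> spectralG h ->
  1 <= alpha -> 1 <= beta ->
  spectralA (f_alpha f alpha) -> spectralA (f_alpha g beta) ->
  0 <= lambda <= 1 ->
  (forall (G : graph) (P : gV G -> R), (0 < #|gV G|)%N -> is_dist P ->
     ln (refine h P) = lambda * ln (refine f P) + (1 - lambda) * ln (refine g P)) ->
  spectralA (f_alpha h (lambda * alpha + (1 - lambda) * beta)).
Proof.
move=> f_spec g_spec h_spec _ _ fA gA /andP[lambda0 lambda1] refine_convex.
apply/spectralA_f_alphaP => // W W' phi A c cohomA.
apply: (wvalue_le_of_log_wrefine_le h_spec (phi := phi)) => k k_gt0.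
rewrite !(log_wrefine_convex_comb _ _ f_spec g_spec h_spec refine_convex) ?sum_push_counts //.
have f_le := log_wrefine_le_of_block_cohom f_spec k fA cohomA.
have g_le := log_wrefine_le_of_block_cohom g_spec k gA cohomA.
by rewrite lerD // ler_wpM2l // subr_ge0.
Qed.
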